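(* Consider an electrical circuit, modeled as described in the context, whose incremental resistance and conductance matrices $R$ and $G$ are positive definite. An equilibrium point of this circuit is regular if and only if (i) the elastances $E_m$, $E_c$ of $q$-memristors and capacitors and the reluctances $\mathcal{R}_w$, $\mathcal{R}_l$ of $\varphi$-memristors and inductors are non-singular at the equilibrium, and (ii) the circuit has neither VLW-loops nor ICM-cutsets.
   Context: Circuit setting. The circuit has an underlying digraph $\mathcal{G}$ with $n$ nodes, $m$ branches and $k$ connected components. A cutset is a set of branches whose removal increases the number of connected components and which is minimal with this property; a loop is a cycle of branches. Let $B$ be a reduced loop matrix (full-row-rank set of rows of the loop matrix, entries $1,-1,0$ according as a branch is in a loop with the same orientation, opposite orientation, or not at all) and $D$ a reduced cutset matrix (analogous with oriented cutsets), with columns in the same branch order. Each branch carries a voltage $v$ and current $i$ and belongs to one of eight classes. $q$-devices ($v=\eta(q,i,t)$, $C^1$): $q$-memristors $v_m=\eta_1(q_m,i_m,t)$ (with $\partial\eta_1/\partial q_m\not\equiv0$, $\partial\eta_1/\partial i_m\not\equiv0$), capacitors $v_c=\eta_2(q_c,t)$, current-controlled resistors $v_r=\eta_3(i_r,t)$, voltage sources $v_u=\eta_4(t)$. $\varphi$-devices ($i=\zeta(\varphi,v,t)$, $C^1$): $\varphi$-memristors $i_w=\zeta_1(\varphi_w,v_w,t)$ (with $\partial\zeta_1/\partial\varphi_w\not\equiv0$, $\partial\zeta_1/\partial v_w\not\equiv0$), inductors $i_l=\zeta_2(\varphi_l,t)$, voltage-controlled resistors $i_g=\zeta_3(v_g,t)$,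 current sources $i_j=\zeta_4(t)$. Maps may be vector-valued. With $B=(B_q\ B_\varphi)$, $D=(D_q\ D_\varphi)$ split by $q$- and $\varphi$-devices, and $q_{mc}=(q_m,q_c)$, $\varphi_{wl}=(\varphi_w,\varphi_l)$, the circuit is modeled by the semiexplicit differential-algebraic system $q_{mc}'=i_{mc}$, $\varphi_{wl}'=v_{wl}$, $0=v_q-f(q_{mc},i_q,t)$, $0=i_\varphi-g(\varphi_{wl},v_\varphi,t)$, $0=B_qv_q+B_\varphi v_\varphi$, $0=D_qi_q+D_\varphi i_\varphi$, where $f$ collects $\eta_1,\dots,\eta_4$ and $g$ collects $\zeta_1,\dots,\zeta_4$. An equilibrium point is a point $(q_{mc},\varphi_{wl},v_q,i_q,v_\varphi,i_\varphi)$ at which the right-hand sides of all these equations vanish; it is regular if the Jacobian matrix $K$ of these right-hand sides with respect to $(q_{mc},\varphi_{wl},v_q,i_q,v_\varphi,i_\varphi)$ is non-singular there. Characteristic matrices: resistance $R=\partial\eta_3/\partial i_r$, conductance $G=\partial\zeta_3/\partial v_g$, elastances $E_m=\partial\eta_1/\partial q_m$, $E_c=\partial\eta_2/\partial q_c$, reluctances $\mathcal{R}_w=\partial\zeta_1/\partial\varphi_w$, $\mathcal{R}_l=\partial\zeta_2/\partial\varphi_l$. A square matrix $P$ is positive definite if $u^TPu>0$ for all $u\ne0$ (symmetry not assumed). A VLW-loop is a loop consisting only of voltage sources, inductors and/or $\varphi$-memristors; an ICM-cutset is a cutset consisting only of current sources, capacitors and/or $q$-memristors. *)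

(* Defs.v *)
From HB Require Import structures.
From mathcomp Require Import all_boot all_order all_algebra.
From mathcomp Require Import boolp classical_sets reals topology normedtype derive.
Set Implicit Arguments.
Unset Strict Implicit.
Unset Printing Implicit Defensive.
Import Order.TTheory GRing.Theory Num.Theory.
Import numFieldNormedType.Exports.
Local Open Scope ring_scope.

Definition pjac (R : realType) (a b : nat) (f : 'rV[R]_a -> 'rV[R]_b)
    (x : 'rV[R]_a) : 'M[R]_(b, a) :=
  \matrix_(k < b, l < a)
     derive1 (fun h : R => f (x + h *: delta_mx 0 l) 0 k) 0.

Definition C1 (R : realType) (a b : nat) (f : 'rV[R]_a -> 'rV[R]_b) : Prop :=
  forall (k : 'I_b) (l : 'I_a),
    (forall x : 'rV[R]_a,
        derivable (fun h : R => f (x + h *: delta_mx 0 l) 0 k) 0 1)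
    /\ continuous (fun x : 'rV[R]_a => pjac f x k l).

Definition posdef (R : realType) (k : nat) (P : 'M[R]_k) : Prop :=
  forall u : 'rV[R]_k, u != 0 -> 0 < (u *m P *m u^T) 0 0.

Definition nonsingular (R : realType) (r c : nat) (A : 'M[R]_(r, c)) : Prop :=
  exists e : r = c, castmx (e, erefl c) A \in unitmx.

Definition is_cycle (n m : nat) (src tgt : 'I_m -> 'I_n) (k : nat)
    (xs : 'I_k.+1 -> 'I_n) (bs : 'I_k.+1 -> 'I_m) : Prop :=
  injective xs /\ injective bs /\
  forall j : 'I_k.+1,
    (src (bs j) = xs j /\ tgt (bs j) = xs (ordS j)) \/
    (tgt (bs j) = xs j /\ src (bs j) = xs (ordS j)).

Definition loop_vec (R : realType) (n m : nat) (src : 'I_m -> 'I_n) (k : nat)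
    (xs : 'I_k.+1 -> 'I_n) (bs : 'I_k.+1 -> 'I_m) : 'rV[R]_m :=
  \row_b (if [pick j | bs j == b] is Some j then
            (if src b == xs j then 1 else -1) else 0).

Definition is_loop_row (R : realType) (n m : nat) (src tgt : 'I_m -> 'I_n)
    (v : 'rV[R]_m) : Prop :=
  exists k (xs : 'I_k.+1 -> 'I_n) (bs : 'I_k.+1 -> 'I_m),
    is_cycle src tgt xs bs /\ v = loop_vec R src xs bs.

Definition adj (n m : nat) (src tgt : 'I_m -> 'I_n) (K : {set 'I_m}) :
    rel 'I_n :=
  fun x y => [exists b in K, ((src b == x) && (tgt b == y))
                             || ((src b == y) && (tgt b == x))].

Definition ncomp (n m : nat) (src tgt : 'I_m -> 'I_n) (K : {set 'I_m}) : nat :=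
  #|[set [set y | connect (adj src tgt K) x y] | x : 'I_n]|.

Definition disconnecting (n m : nat) (src tgt : 'I_m -> 'I_n) (S : {set 'I_m})
  : Prop := (ncomp src tgt [set: 'I_m] < ncomp src tgt (~: S))%N.

Definition is_cutset (n m : nat) (src tgt : 'I_m -> 'I_n) (S : {set 'I_m})
  : Prop :=
  disconnecting src tgt S /\
  forall S' : {set 'I_m}, S' \proper S -> ~ disconnecting src tgt S'.

Definition cut_vec (R : realType) (n m : nat) (src tgt : 'I_m -> 'I_n)
    (X : {set 'I_n}) : 'rV[R]_m :=
  \row_b (if (src b \in X) && (tgt b \notin X) then 1
          else if (tgt b \in X) && (src b \notin X) then -1 else 0).

Definition is_cutset_row (R : realType) (n m : nat) (src tgt : 'I_m -> 'I_n)
    (v : 'rV[R]_m) : Prop :=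
  exists (S : {set 'I_m}) (X : {set 'I_n}),
    is_cutset src tgt S /\
    S = [set b | (src b \in X) != (tgt b \in X)] /\
    v = cut_vec R src tgt X.

Definition reduced_loop_matrix (R : realType) (n m p : nat)
    (src tgt : 'I_m -> 'I_n) (B : 'M[R]_(p, m)) : Prop :=
  (forall i, is_loop_row src tgt (row i B)) /\ row_free B /\
  (forall v : 'rV[R]_m, is_loop_row src tgt v -> (v <= B)%MS).

Definition reduced_cutset_matrix (R : realType) (n m s : nat)
    (src tgt : 'I_m -> 'I_n) (D : 'M[R]_(s, m)) : Prop :=
  (forall i, is_cutset_row src tgt (row i D)) /\ row_free D /\
  (forall v : 'rV[R]_m, is_cutset_row src tgt v -> (v <= D)%MS).

(* Devices. Branch order: q_m, c, r, u (q-devices) then w, l, g, j      *)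
(* (phi-devices), with nm, nc, nr, nu, nw, nl, ng, nj branches.         *)

Inductive dclass := Qmem | Cap | CRes | VSrc | Pmem | Ind | VRes | ISrc.

Definition dclass_of (nm nc nr nu nw nl ng nj : nat)
    (b : 'I_((nm + nc + (nr + nu)) + (nw + nl + (ng + nj)))) : dclass :=
  let x := nat_of_ord b in
  if (x < nm)%N then Qmem
  else if (x < nm + nc)%N then Cap
  else if (x < nm + nc + nr)%N then CRes
  else if (x < nm + nc + (nr + nu))%N then VSrc
  else if (x < nm + nc + (nr + nu) + nw)%N then Pmem
  else if (x < nm + nc + (nr + nu) + (nw + nl))%N then Ind
  else if (x < nm + nc + (nr + nu) + (nw + nl + ng))%N then VRes
  else ISrc.

Definition has_VLW_loop (n nm nc nr nu nw nl ng nj : nat)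
    (src tgt : 'I_((nm + nc + (nr + nu)) + (nw + nl + (ng + nj))) -> 'I_n)
    : Prop :=
  exists k xs (bs : 'I_k.+1 -> _),
    is_cycle src tgt xs bs /\
    forall j, let c := dclass_of (bs j) in c = VSrc \/ c = Ind \/ c = Pmem.

Definition has_ICM_cutset (n nm nc nr nu nw nl ng nj : nat)
    (src tgt : 'I_((nm + nc + (nr + nu)) + (nw + nl + (ng + nj))) -> 'I_n)
    : Prop :=
  exists S, is_cutset src tgt S /\
    forall b, b \in S -> let c := dclass_of b in c = ISrc \/ c = Cap \/ c = Qmem.

Definition fq (R : realType) (nm nc nr nu : nat)
    (eta1 : 'rV[R]_nm -> 'rV[R]_nm -> R -> 'rV[R]_nm)
    (eta2 : 'rV[R]_nc -> R -> 'rV[R]_nc)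
    (eta3 : 'rV[R]_nr -> R -> 'rV[R]_nr)
    (eta4 : R -> 'rV[R]_nu)
    (qmc : 'rV[R]_(nm + nc)) (iq : 'rV[R]_(nm + nc + (nr + nu))) (t : R)
    : 'rV[R]_(nm + nc + (nr + nu)) :=
  row_mx (row_mx (eta1 (lsubmx qmc) (lsubmx (lsubmx iq)) t)
                 (eta2 (rsubmx qmc) t))
         (row_mx (eta3 (lsubmx (rsubmx iq)) t) (eta4 t)).

Definition gphi (R : realType) (nw nl ng nj : nat)
    (zeta1 : 'rV[R]_nw -> 'rV[R]_nw -> R -> 'rV[R]_nw)
    (zeta2 : 'rV[R]_nl -> R -> 'rV[R]_nl)
    (zeta3 : 'rV[R]_ng -> R -> 'rV[R]_ng)
    (zeta4 : R -> 'rV[R]_nj)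
    (pwl : 'rV[R]_(nw + nl)) (vp : 'rV[R]_(nw + nl + (ng + nj))) (t : R)
    : 'rV[R]_(nw + nl + (ng + nj)) :=
  row_mx (row_mx (zeta1 (lsubmx pwl) (lsubmx (lsubmx vp)) t)
                 (zeta2 (rsubmx pwl) t))
         (row_mx (zeta3 (lsubmx (rsubmx vp)) t) (zeta4 t)).

Definition state_vec (R : realType) (a b c d : nat)
    (qmc : 'rV[R]_a) (pwl : 'rV[R]_b) (vq iq : 'rV[R]_c) (vp ip : 'rV[R]_d)
    : 'rV[R]_(a + (b + (c + (c + (d + d))))) :=
  row_mx qmc (row_mx pwl (row_mx vq (row_mx iq (row_mx vp ip)))).

(* The right-hand sides of the semiexplicit DAE, as a function of the
   state vector, at time t:
     (i_mc, v_wl, v_q - f, i_phi - g, B_q v_q + B_phi v_phi,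
      D_q i_q + D_phi i_phi). *)
Definition circuit_rhs (R : realType) (nm nc nr nu nw nl ng nj p s : nat)
    (B : 'M[R]_(p, (nm + nc + (nr + nu)) + (nw + nl + (ng + nj))))
    (D : 'M[R]_(s, (nm + nc + (nr + nu)) + (nw + nl + (ng + nj))))
    (eta1 : 'rV[R]_nm -> 'rV[R]_nm -> R -> 'rV[R]_nm)
    (eta2 : 'rV[R]_nc -> R -> 'rV[R]_nc)
    (eta3 : 'rV[R]_nr -> R -> 'rV[R]_nr)
    (eta4 : R -> 'rV[R]_nu)
    (zeta1 : 'rV[R]_nw -> 'rV[R]_nw -> R -> 'rV[R]_nw)
    (zeta2 : 'rV[R]_nl -> R -> 'rV[R]_nl)
    (zeta3 : 'rV[R]_ng -> R -> 'rV[R]_ng)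
    (zeta4 : R -> 'rV[R]_nj) (t : R)
    (x : 'rV[R]_((nm + nc) + ((nw + nl) + ((nm + nc + (nr + nu))
          + ((nm + nc + (nr + nu)) + ((nw + nl + (ng + nj))
          + (nw + nl + (ng + nj))))))))
    : 'rV[R]_((nm + nc) + ((nw + nl) + ((nm + nc + (nr + nu))
          + ((nw + nl + (ng + nj)) + (p + s))))) :=
  let qmc : 'rV[R]_(nm + nc) := lsubmx x in
  let r1 := rsubmx x in
  let pwl : 'rV[R]_(nw + nl) := lsubmx r1 in
  let r2 := rsubmx r1 in
  let vq : 'rV[R]_(nm + nc + (nr + nu)) := lsubmx r2 in
  let r3 := rsubmx r2 in
  let iq : 'rV[R]_(nm + nc + (nr + nu)) := lsubmx r3 in
  let r4 := rsubmx r3 in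
  let vp : 'rV[R]_(nw + nl + (ng + nj)) := lsubmx r4 in
  let ip : 'rV[R]_(nw + nl + (ng + nj)) := rsubmx r4 in
  row_mx (lsubmx iq)
  (row_mx (lsubmx vp)
  (row_mx (vq - fq eta1 eta2 eta3 eta4 qmc iq t)
  (row_mx (ip - gphi zeta1 zeta2 zeta3 zeta4 pwl vp t)
  (row_mx (vq *m (lsubmx B)^T + vp *m (rsubmx B)^T)
          (iq *m (lsubmx D)^T + ip *m (rsubmx D)^T))))).

(* Main.v *)
Require Import Defs.
From HB Require Import structures.
From mathcomp Require Import all_boot all_order all_algebra.
From mathcomp Require Import zify.
From mathcomp Require Import boolp classical_sets functions reals topology normedtype derive.
Import Order.TTheory GRing.Theory Num.Theory.
Import numFieldNormedType.Exports.
Local Open Scope ring_scope.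

(** A kernel vector of the Jacobian consists of increments of charges, fluxes,
    voltages and currents. Its voltage part v is orthogonal to all loops and its
    current part i to all cutsets, so v is a tension, i a circulation and v.i = 0
    (Tellegen). In v.i only the resistors survive, hence they vanish by positive
    definiteness; then v is supported on ICM branches and i on VLW branches.
    A nonzero tension contains a cutset in its support and a nonzero circulation
    a loop, so (ii) forces v = i = 0 and (i) kills the charges and fluxes.
    Conversely a singular elastance or reluctance, a VLW-loop or an ICM-cutset
    yields a kernel vector. The Jacobian is square because the elementary
    vectors, i.e. loops and cutsets, span two orthogonal complements. *)

Set Implicit Arguments.
Unset Strict Implicit.

(* Subtracting a suitable multiple of w from v shrinks the support of v. *)
Lemma submx_of_elementary (F : fieldType) (a b m : nat)
    (V : 'M[F]_(a, m)) (W : 'M[F]_(b, m)) :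
  (forall v : 'rV_m, (v <= V)%MS -> v != 0 ->
     exists w : 'rV_m, [/\ (w <= V)%MS, (w <= W)%MS, w != 0 &
       forall l, w 0 l != 0 -> v 0 l != 0]) ->
  (V <= W)%MS.
Proof.
move=> elem; apply/rV_subP => v.
have [N] := ubnP #|[set l | v 0 l != 0]|.
elim: N v => // N IHN v lt_v vV.
have [->|v0] := eqVneq v 0; first exact: sub0mx.
have [w [wV wW w0 wv]] := elem v vV v0.
have [l wl] : exists l, w 0 l != 0 by apply/rV0Pn.
pose u := v - (v 0 l / w 0 l) *: w.
have -> : v = u + (v 0 l / w 0 l) *: w by rewrite subrK.
apply: addmx_sub; last exact: scalemx_sub.
apply: IHN; last by rewrite addmx_sub // -scaleNr scalemx_sub.
rewrite -ltnS; apply: leq_trans lt_v; rewrite ltnS; apply: proper_card; apply/properP; split.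
  apply/fintype.subsetP => l'; rewrite !inE !mxE; apply: contraNneq => vl'.
  have /eqP -> : w 0 l' == 0.
    by apply: contraTT (eqxx (v 0 l')) => /wv; rewrite {1}vl' eqxx.
  by rewrite vl' mulr0 subr0.
by exists l; rewrite !inE ?wv// !mxE divfK ?subrr ?eqxx.
Qed.

(** * Circulations, tensions, loops and cutsets *)

(** The node-branch incidence matrix; a self-loop gives a zero column. Its row space is the space of
    tensions, and [i *m A^T = 0] is Kirchhoff's current law. The matrices [B] and [D] are compared
    with it. *)
Definition incidence (R : realType) (n m : nat) (src tgt : 'I_m -> 'I_n) :
    'M[R]_(n, m) :=
  \matrix_(x, b) ((src b == x)%:R - (tgt b == x)%:R).

Section Graph.
Variables (R : realType) (n m : nat) (src tgt : 'I_m -> 'I_n).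
Local Notation A := (incidence R src tgt).

Lemma mul_incidenceE (pot : 'rV[R]_n) b :
  (pot *m A) 0 b = pot 0 (src b) - pot 0 (tgt b).
Proof.
rewrite mxE; under eq_bigr do rewrite mxE mulrBr.
rewrite sumrB; congr (_ - _).
  rewrite (bigD1 (src b)) //= eqxx mulr1 big1 ?addr0 // => x.
  by rewrite eq_sym => /negPf ->; rewrite mulr0.
rewrite (bigD1 (tgt b)) //= eqxx mulr1 big1 ?addr0 // => x.
by rewrite eq_sym => /negPf ->; rewrite mulr0.
Qed.

Lemma cut_vec_incidence (X : {set 'I_n}) :
  cut_vec R src tgt X = (\row_x (x \in X)%:R) *m A.
Proof.
apply/rowP => b; rewrite mul_incidenceE !mxE.
by do 2 case: (_ \in X); rewrite /= ?subr0 ?subrr ?sub0r.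
Qed.

(** The sum form allows exchanging sums over branches with sums over positions in the cycle;
    injectivity of [bs] leaves at most one term. *)
Lemma loop_vecE k (xs : 'I_k.+1 -> 'I_n) (bs : 'I_k.+1 -> 'I_m) b :
    injective bs ->
  loop_vec R src xs bs 0 b =
    \sum_(j | bs j == b) (if src (bs j) == xs j then 1 else -1).
Proof.
move=> bsI; rewrite mxE; case: pickP => [j /eqP <-|noj]; last by rewrite big_pred0.
by rewrite (big_pred1 j) // => j'; rewrite /= (inj_eq bsI).
Qed.

Lemma loop_vec_neq0 k (xs : 'I_k.+1 -> 'I_n) (bs : 'I_k.+1 -> 'I_m) b :
  (loop_vec R src xs bs 0 b != 0) = [exists j, bs j == b].
Proof.
rewrite mxE; case: pickP => [j bj|noj].
  have -> : [exists j, bs j == b] by apply/existsP; exists j.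
  by case: ifP; rewrite ?oppr_eq0 oner_eq0.
by rewrite eqxx; apply/esym/negbTE/existsPn => j; rewrite noj.
Qed.

(** Summed over positions, each branch contributes the indicator of [xs j] minus that of
    [xs (ordS j)], which telescopes around the cycle. *)
Lemma loop_vec_circulation k (xs : 'I_k.+1 -> 'I_n) (bs : 'I_k.+1 -> 'I_m) :
  is_cycle src tgt xs bs -> loop_vec R src xs bs *m A^T = 0.
Proof.
move=> [xsI [bsI ends]]; apply/rowP => x; rewrite mxE [RHS]mxE.
under eq_bigr do rewrite loop_vecE // mulr_suml.
rewrite (exchange_big_dep predT) //=.
rewrite (eq_bigr (fun j => (xs j == x)%:R - (xs (ordS j) == x)%:R)); last first.
  move=> j _; rewrite (big_pred1 (bs j)); last by move=> b; rewrite /= eq_sym.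
  rewrite !mxE; case: (ends j) => -[-> ->]; first by rewrite eqxx mul1r.
  (* A branch traversed backwards whose source is still [xs j] is a self-loop, and both sides
     vanish. *)
  case: eqVneq => [->|_]; first by rewrite !subrr mulr0.
  by rewrite mulN1r opprB.
rewrite sumrB [X in _ - X](_ : _ = \sum_j (xs j == x)%:R) ?subrr //.
by rewrite [RHS](reindex_inj (@ordS_inj k.+1)).
Qed.

Lemma cycle_of_iter (f : 'I_n -> 'I_n) (x : 'I_n) :
  exists k (y : 'I_n), injective (fun j : 'I_k.+1 => iter j f y)
    /\ iter k.+1 f y = y /\ exists l, y = iter l f x.
Proof.
have /trajectP[i lt_i eq_i] := looping_order f x.
(* The orbit enters its cycle after [i] steps and has period [order f x - i]; the predecessor
   compensates for the index type ['I_k.+1]. *)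
exists (order f x - i).-1, (iter i f x).
have dE : (order f x - i).-1.+1 = (order f x - i)%N by rewrite prednK ?subn_gt0.
rewrite dE -iterD subnK ?(ltnW lt_i) //; split; last by split=> //; exists i.
move=> j1 j2; rewrite -!iterD => eq12; apply/val_inj/eqP.
have lt (j : 'I_(order f x - i)) : (j + i < order f x)%N.
  by rewrite addnC -ltn_subRL.
rewrite -(eqn_add2r i) -(nth_uniq x _ _ (orbit_uniq f x)) ?size_traject ?lt //.
by rewrite !nth_traject ?lt //; exact/eqP.
Qed.

(* Orient the branches of the support along the current: by KCL every branch of
   the support can be followed by another one, so iterating heads must close up. *)
Lemma circulation_support_cycle (i : 'rV[R]_m) :
    i *m A^T = 0 -> i != 0 ->
  exists k (xs : 'I_k.+1 -> 'I_n) (bs : 'I_k.+1 -> 'I_m),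
    is_cycle src tgt xs bs /\ forall j, i 0 (bs j) != 0.
Proof.
move=> kcl /rV0Pn[b0 ib0].
(* Tails and heads follow the direction of positive flow; the choice on branches without current is
   immaterial. *)
pose tl b := if 0 < i 0 b then src b else tgt b.
pose hd b := if 0 < i 0 b then tgt b else src b.
have kclE x : \sum_b `|i 0 b| * ((tl b == x)%:R - (hd b == x)%:R) = 0.
  transitivity ((i *m A^T) 0 x); last by rewrite kcl mxE.
  rewrite mxE; apply: eq_bigr => b _; rewrite !mxE /tl /hd.
  case: ltP => [/gtr0_norm ->|/ler0_norm ->] //.
  by rewrite mulNr -mulrN opprB.
(* If no branch of the support left [hd b], the current law there would be a vanishing sum of
   nonnegative inflows, one of them the positive inflow of [b]. *)
have follow b : i 0 b != 0 -> exists2 b', i 0 b' != 0 & tl b' = hd b.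
  move=> ib; apply: contrapT => noout.
  have tlF b' : i 0 b' != 0 -> tl b' == hd b = false.
    by move=> ib'; apply/eqP => e; apply: noout; exists b'.
  have : \sum_b' `|i 0 b'| * (hd b' == hd b)%:R = 0.
    rewrite -[RHS]oppr0 -[in RHS](kclE (hd b)) -sumrN; apply: eq_bigr => b' _.
    have [->|ib'] := eqVneq (i 0 b') 0; first by rewrite normr0 !mul0r oppr0.
    by rewrite tlF // sub0r mulrN opprK.
  move/eqP; rewrite psumr_eq0 => [/allP/(_ b)|b' _]; last by rewrite mulr_ge0.
  by rewrite mem_index_enum eqxx mulr1 normr_eq0 (negPf ib) => /(_ isT).
(* The default [b0] is harmless: by [orbP], every node of the periodic orbit has an outgoing branch
   in the support. *)
pose out x := odflt b0 [pick b | (i 0 b != 0) && (tl b == x)].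
have outP x : (exists2 b, i 0 b != 0 & tl b = x) ->
    i 0 (out x) != 0 /\ tl (out x) = x.
  move=> [b ib tb]; rewrite /out; case: pickP => [b' /andP[? /eqP]|/(_ b)] //.
  by rewrite ib tb eqxx.
pose nxt x := hd (out x).
have [k [y [iterI [iter_y [l yE]]]]] := cycle_of_iter nxt (tl b0).
have orbP j : i 0 (out (iter j nxt y)) != 0
    /\ tl (out (iter j nxt y)) = iter j nxt y.
  apply: (outP (iter j nxt y)); rewrite yE -iterD.
  elim: (j + l)%N => [|h [b ib tb]]; first by exists b0.
  rewrite iterS; apply: follow.
  by have [] := outP (iter h nxt (tl b0)); first by exists b.
exists k, (fun j => iter j nxt y), (fun j => out (iter j nxt y)).
split; last by move=> j; case: (orbP j).
split=> //; split=> [j1 j2 eq12|j].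
  (* The tail of a chosen branch recovers its node, so distinct nodes have distinct branches. *)
  by apply: iterI; rewrite -(orbP j1).2 eq12 (orbP j2).2.
(* [ordS] is the successor modulo [k.+1]; at the last position it wraps to [0], where the
   periodicity [iter_y] is needed. *)
have -> : iter (ordS j) nxt y = hd (out (iter j nxt y)).
  rewrite -[hd _]/(nxt _) -iterS -[nat_of_ord _]/(j.+1 %% k.+1)%N.
  have [lt_j|] := ltnP j.+1 k.+1; first by rewrite modn_small.
  move=> le_j; have -> : j.+1 = k.+1 by apply/eqP; rewrite eqn_leq le_j ltn_ord.
  by rewrite modnn iter_y.
move: (orbP j).2; rewrite /=; set b := out _ => <-; rewrite /tl /hd.
by case: ifP => _; [left|right].
Qed.

(** * Disconnecting sets, cutsets and supports of tensions *)

Lemma adj_sym K : connect_sym (adj src tgt K).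
Proof.
apply: sym_connect_sym => x y; apply: eq_existsb => b; congr (_ && _).
by rewrite orbC.
Qed.

Lemma adj_branch (K : {set 'I_m}) b :
  b \in K -> connect (adj src tgt K) (src b) (tgt b).
Proof.
by move=> bK; apply: connect1; apply/exists_inP; exists b; rewrite ?eqxx.
Qed.

(** Applied below to membership in a node set and to a potential. *)
Lemma connect_adj_const (T : eqType) (K : {set 'I_m}) (g : 'I_n -> T) :
    (forall b, b \in K -> g (src b) = g (tgt b)) ->
  forall x y, connect (adj src tgt K) x y -> g x = g y.
Proof.
move=> gK x y /connectP[q + ->]; elim: q x => //= z q IHq x /andP[xz zq].
rewrite -(IHq z zq); case/exists_inP: xz => b bK.
by case/orP => /andP[/eqP <- /eqP <-]; rewrite gK.
Qed.

(** Each component left by the removal of [S] lies in one component of the full graph, and this map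
    is onto. The count grows exactly when the map is not injective, that is, when some branch has
    its ends separated. *)
Lemma disconnectingP (S : {set 'I_m}) :
  disconnecting src tgt S <->
  exists b, ~~ connect (adj src tgt (~: S)) (src b) (tgt b).
Proof.
pose cT := connect (adj src tgt [set: 'I_m]).
pose cS := connect (adj src tgt (~: S)).
have sub_cS x y : cS x y -> cT x y.
  apply: connect_sub => {}x {}y /exists_inP[b _ h]; apply: connect1.
  by apply/exists_inP; exists b.
split=> [dis|[b nb]].
  apply: contrapT => nob; move: dis; rewrite /disconnecting /ncomp.
  have conn b : cS (src b) (tgt b).
    by apply: contrapT => /negP h; apply: nob; exists b.
  have eqc : cT =2 cS.
    move=> x y; apply/idP/idP; last exact: sub_cS.
    apply: connect_sub => {}x {}y /exists_inP[b _ h].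
    by case/orP: h => /andP[/eqP <- /eqP <-] //; rewrite /cS adj_sym.
  suff -> : [set [set y | cT x y] | x : 'I_n] = [set [set y | cS x y] | x : 'I_n].
    by rewrite ltnn.
  by apply: eq_imset => x; apply/setP => y; rewrite !inE eqc.
rewrite /disconnecting /ncomp -/cT -/cS.
(* Sends a component of the reduced graph to the component of the full graph around it. *)
pose F (Y : {set 'I_n}) := [set y | [exists z in Y, cT z y]].
have FE x : F [set y | cS x y] = [set y | cT x y].
  apply/setP => y; rewrite !inE; apply/exists_inP/idP => [[z]|xy].
    by rewrite inE => /sub_cS; exact: connect_trans.
  by exists x; rewrite ?inE //; exact: connect0.
have -> : [set [set y | cT x y] | x : 'I_n] = F @: [set [set y | cS x y] | x : 'I_n].
  by rewrite -imset_comp; apply: eq_imset => x /=; rewrite FE.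
rewrite ltn_neqAle leq_imset_card andbT; apply: contra nb => /imset_injP Finj.
have /Finj : F [set y | cS (src b) y] = F [set y | cS (tgt b) y].
  rewrite !FE; apply/setP => y; rewrite !inE.
  exact: (same_connect (adj_sym _) (adj_branch (finset.in_setT b))).
have classP x : [set y | cS x y] \in [set [set y | cS x y] | x : 'I_n].
  by apply/imsetP; exists x.
move=> /(_ (classP _) (classP _))/setP/(_ (tgt b)).
by rewrite !inE /cS connect0.
Qed.

(** For a branch [b] separated by [S], take as [X] the component of [src b] after removal. Its
    boundary lies in [S] and still separates [b], so minimality makes it all of [S]. *)
Lemma cutset_boundary (S : {set 'I_m}) :
    is_cutset src tgt S ->
  exists X : {set 'I_n}, S = [set b | (src b \in X) != (tgt b \in X)].
Proof.
move=> [/disconnectingP[b nb] minS].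
pose X := [set y | connect (adj src tgt (~: S)) (src b) y].
exists X; set S' := [set _ | _].
have sS'S : S' \subset S.
  apply/fintype.subsetP => b'; rewrite !inE; apply: contraR => nSb'.
  apply/eqP/same_connect_r; first exact: adj_sym.
  by apply: adj_branch; rewrite inE.
have /eqVproper[//|S'S] := sS'S.
case: (minS S' S'S); apply/disconnectingP; exists b.
apply/negP => /(connect_adj_const (g := fun x => x \in X)) h.
move: nb; have : src b \in X by rewrite inE connect0.
rewrite h ?inE => [->//|b'].
by rewrite !inE negbK => /eqP.
Qed.

(** Descent on cardinality: pass to proper disconnecting subsets until none is left. *)
Lemma disconnecting_cutset (S : {set 'I_m}) :
    disconnecting src tgt S ->
  exists2 S' : {set 'I_m}, S' \subset S & is_cutset src tgt S'.
Proof.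
have [N] := ubnP #|S|; elim: N S => // N IHN S ltS dS.
have [min|] := pselect (forall S' : {set 'I_m}, S' \proper S -> ~ disconnecting src tgt S').
  by exists S.
move=> /existsNP[S' /not_implyP[S'S /contrapT dS']].
have [|S2 S2S' cS2] := IHN S' _ dS'.
  by rewrite -ltnS; apply: leq_trans ltS; rewrite ltnS proper_card.
by exists S2 => //; apply: fintype.subset_trans S2S' (proper_sub S'S).
Qed.

(** Once the support of [v] is removed, the potential is constant on components, so a branch with
    nonzero voltage has its ends separated. Thus the support disconnects and contains a cutset. *)
Lemma tension_support_cutset (v : 'rV[R]_m) :
    (v <= A)%MS -> v != 0 ->
  exists2 S, is_cutset src tgt S & forall b, b \in S -> v 0 b != 0.
Proof.
move=> /submxP[pot ->] /rV0Pn[b vb].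
set v' := pot *m _ in vb *.
have /disconnecting_cutset[S' /fintype.subsetP S'S cS'] :
    disconnecting src tgt [set b | v' 0 b != 0].
  apply/disconnectingP; exists b; apply: contraNN vb.
  move=> /(connect_adj_const (g := fun x => pot 0 x)) h.
  rewrite /v' mul_incidenceE h ?subrr ?eqxx // => b'.
  by rewrite !inE negbK /v' mul_incidenceE subr_eq0 => /eqP.
by exists S' => // b' /S'S; rewrite inE.
Qed.

Lemma cut_vec_neq0 (X : {set 'I_n}) b :
  (cut_vec R src tgt X 0 b != 0) = ((src b \in X) != (tgt b \in X)).
Proof.
rewrite mxE.
by do 2 case: (_ \in X); rewrite /= ?oppr_eq0 ?oner_eq0 ?eqxx.
Qed.

Lemma cutset_row (S : {set 'I_m}) :
    is_cutset src tgt S ->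
  exists v : 'rV[R]_m, [/\ is_cutset_row src tgt v, (v <= A)%MS, v != 0 &
    forall b, v 0 b != 0 -> b \in S].
Proof.
move=> cS; have [X SX] := cutset_boundary cS.
exists (cut_vec R src tgt X); split.
- by exists S, X.
- by rewrite cut_vec_incidence submxMl.
(* A separated branch belongs to [S], as otherwise it would join its own ends; the cut vector is
   nonzero there. *)
- case: cS => /disconnectingP[b nb] _; apply/rV0Pn; exists b.
  rewrite cut_vec_neq0; apply: contraNT nb => bX; apply: adj_branch.
  by rewrite inE SX inE.
- by move=> b; rewrite cut_vec_neq0 SX inE.
Qed.

Lemma cycle_row k (xs : 'I_k.+1 -> 'I_n) (bs : 'I_k.+1 -> 'I_m) :
    is_cycle src tgt xs bs ->
  exists v : 'rV[R]_m, [/\ is_loop_row src tgt v, v *m A^T = 0, v != 0 &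
    forall b, v 0 b != 0 -> exists j, bs j = b].
Proof.
move=> cyc; exists (loop_vec R src xs bs); split.
- by exists k, xs, bs.
- exact: loop_vec_circulation.
- by apply/rV0Pn; exists (bs ord0); rewrite loop_vec_neq0; apply/existsP; exists ord0.
- by move=> b; rewrite loop_vec_neq0 => /existsP[j /eqP]; exists j.
Qed.

(** A nonzero circulation carries a cycle in its support, and the loop vector of that cycle lies in
    both spaces, so [submx_of_elementary] applies. *)
Lemma reduced_loop_matrix_eqmx p (B : 'M[R]_(p, m)) :
  reduced_loop_matrix src tgt B -> (B :=: kermx A^T)%MS.
Proof.
move=> [rowsB [_ loopsB]]; apply/eqmxP/andP; split.
  apply/row_subP => i; apply/sub_kermxP.
  by have [k [xs [bs [cyc ->]]]] := rowsB i; exact: loop_vec_circulation.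
apply: submx_of_elementary => v /sub_kermxP vA v0.
have [k [xs [bs [cyc vbs]]]] := circulation_support_cycle vA v0.
have [w [wl wA w0 wsupp]] := cycle_row cyc.
exists w; split; rewrite ?loopsB //; first exact/sub_kermxP.
by move=> b /wsupp[j <-].
Qed.

(** The dual argument, with cutsets as elementary vectors of the tension space. *)
Lemma reduced_cutset_matrix_eqmx s (D : 'M[R]_(s, m)) :
  reduced_cutset_matrix src tgt D -> (D :=: A)%MS.
Proof.
move=> [rowsD [_ cutsD]]; apply/eqmxP/andP; split.
  apply/row_subP => i; have [S [X [_ [_ ->]]]] := rowsD i.
  by rewrite cut_vec_incidence submxMl.
apply: submx_of_elementary => v vA v0.
have [S cS Sv] := tension_support_cutset vA v0.
have [w [wc wA w0 wsupp]] := cutset_row cS.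
by exists w; split=> //; [exact: cutsD|move=> b /wsupp/Sv].
Qed.

(** Row-freeness turns [p] and [s] into ranks, and rank-nullity adds up the dimensions of
    circulations and tensions. This count makes the Jacobian square. *)
Lemma reduced_matrices_dim p s (B : 'M[R]_(p, m)) (D : 'M[R]_(s, m)) :
    reduced_loop_matrix src tgt B -> reduced_cutset_matrix src tgt D ->
  (p + s)%N = m.
Proof.
move=> HB HD.
have rB : \rank B = p by case: HB => _ [/eqP].
have rD : \rank D = s by case: HD => _ [/eqP].
rewrite -rB -rD (reduced_loop_matrix_eqmx HB) (reduced_cutset_matrix_eqmx HD).
by rewrite mxrank_ker mxrank_tr subnK ?rank_leq_col.
Qed.

(** Tensions are the orthogonal complement of circulations. The columns of [cokermx A] are
    orthogonal to the rows of [A], hence circulations, hence combinations of loops; so a [v]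
    orthogonal to the loops is killed by [cokermx A] and lies in the row space of [A]. *)
Lemma loop_matrix_kernel p (B : 'M[R]_(p, m)) (v : 'rV[R]_m) :
  reduced_loop_matrix src tgt B -> (v *m B^T = 0 <-> (v <= A)%MS).
Proof.
move=> /reduced_loop_matrix_eqmx BA; split=> [vB|/submxP[pot ->]].
  have /submxP[Y cE] : ((cokermx A)^T <= B)%MS.
    by rewrite BA; apply/sub_kermxP; rewrite -trmx_mul mulmx_coker trmx0.
  by rewrite submxE -[cokermx A]trmxK cE trmx_mul mulmxA vB mul0mx.
have /sub_kermxP BA0 : (B <= kermx A^T)%MS by rewrite BA.
by rewrite -mulmxA -[A]trmxK -trmx_mul BA0 trmx0 mulmx0.
Qed.

Lemma cutset_matrix_kernel s (D : 'M[R]_(s, m)) (i : 'rV[R]_m) :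
  reduced_cutset_matrix src tgt D -> (i *m D^T = 0 <-> i *m A^T = 0).
Proof.
move=> /reduced_cutset_matrix_eqmx DA; split=> i0.
  have /submxP[Y ->] : (A <= D)%MS by rewrite DA.
  by rewrite trmx_mul mulmxA i0 mul0mx.
have /submxP[Y ->] : (D <= A)%MS by rewrite DA.
by rewrite trmx_mul mulmxA i0 mul0mx.
Qed.

End Graph.

(** * Jacobian matrices of partial derivatives *)

(** [derive1] is a totalized limit, so [pjac] always has a value; existence of the limit matters
    when a sign is pulled out, in [pjacN]. *)
Definition partially_derivable (R : realType) (a b : nat)
    (f : 'rV[R]_a -> 'rV[R]_b) (x : 'rV[R]_a) : Prop :=
  forall k l, derivable (fun h : R => f (x + h *: delta_mx 0 l) 0 k) 0 1.

Section PartialJacobian.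
Variable R : realType.

Lemma pjac_cst a b (c : 'rV[R]_b) (x : 'rV[R]_a) : pjac (fun=> c) x = 0.
Proof. by apply/matrixP => k l; rewrite !mxE derive1_cst. Qed.

Lemma pjac_linear a b (M : 'M[R]_(a, b)) (x : 'rV[R]_a) :
  pjac (fun y => y *m M) x = M^T.
Proof.
apply/matrixP => k l; rewrite !mxE.
have -> : (fun h : R => ((x + h *: delta_mx 0 l) *m M) 0 k) =
    cst ((x *m M) 0 k) + M l k \*: id.
  apply/funext => h /=; rewrite mulmxDl -scalemxAl -rowE !mxE.
  by rewrite [h * _]mulrC.
rewrite derive1E deriveD ?deriveZ ?derive_cst ?derive_id ?add0r //.
  exact: mulr1.
Qed.

Lemma pjac_id a (x : 'rV[R]_a) : pjac id x = 1%:M.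
Proof.
rewrite -[RHS]trmx1 -(pjac_linear 1%:M x); congr (pjac _ x).
by apply/funext => y; rewrite mulmx1.
Qed.

(** The difference quotients already coincide, so derivability of [f] is not assumed. *)
Lemma pjac_Dcst a b (f : 'rV[R]_a -> 'rV[R]_b) c x :
  pjac (fun y => f y + c) x = pjac f x.
Proof.
apply/matrixP => k l; rewrite !mxE /derive1.
apply: (congr1 (fun F => lim F)); apply: (congr1 (fun g => fmap g _)).
apply/funext => h /=.
by rewrite !mxE opprD addrACA subrr addr0.
Qed.

Lemma pjac_cstD a b (f : 'rV[R]_a -> 'rV[R]_b) c x :
  pjac (fun y => c + f y) x = pjac f x.
Proof.
rewrite -(pjac_Dcst f c); congr (pjac _ x).
by apply/funext => y; rewrite addrC.
Qed.

Lemma pjacN a b (f : 'rV[R]_a -> 'rV[R]_b) x :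
  partially_derivable f x -> pjac (fun y => - f y) x = - pjac f x.
Proof.
move=> df; apply/matrixP => k l; rewrite !mxE !derive1E -deriveN //.
by under eq_fun do rewrite mxE.
Qed.

Lemma pjac_row_mx a b c (f : 'rV[R]_a -> 'rV[R]_b) (g : 'rV[R]_a -> 'rV[R]_c) x :
  pjac (fun y => row_mx (f y) (g y)) x = col_mx (pjac f x) (pjac g x).
Proof.
apply/matrixP => k l; rewrite -(fintype.splitK k); case: (fintype.split k) => k' /=.
  by rewrite col_mxEu !mxE; under eq_fun do rewrite row_mxEl.
by rewrite col_mxEd !mxE; under eq_fun do rewrite row_mxEr.
Qed.

(** Moving one coordinate changes only one of the two blocks, so the partial derivatives separate
    without a chain rule. *)
Lemma pjac_arg_row_mx a b c (f : 'rV[R]_(a + b) -> 'rV[R]_c) x y :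
  pjac f (row_mx x y) = row_mx (pjac (fun z => f (row_mx z y)) x)
                               (pjac (fun z => f (row_mx x z)) y).
Proof.
apply/matrixP => k l; rewrite -(fintype.splitK l); case: (fintype.split l) => l' /=.
  rewrite row_mxEl !mxE.
  by under eq_fun do rewrite delta_mx_lshift scale_row_mx scaler0 add_row_mx addr0.
rewrite row_mxEr !mxE.
by under eq_fun do rewrite delta_mx_rshift scale_row_mx scaler0 add_row_mx addr0.
Qed.

Lemma partially_derivable_cst a b (c : 'rV[R]_b) (x : 'rV[R]_a) :
  partially_derivable (fun=> c) x.
Proof. by move=> k l; exact: derivable_cst. Qed.

Lemma partially_derivable_row_mx a b c
    (f : 'rV[R]_a -> 'rV[R]_b) (g : 'rV[R]_a -> 'rV[R]_c) x :
    partially_derivable f x -> partially_derivable g x ->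
  partially_derivable (fun y => row_mx (f y) (g y)) x.
Proof.
move=> df dg k l; rewrite -(fintype.splitK k); case: (fintype.split k) => k' /=.
  by under eq_fun do rewrite row_mxEl; exact: df.
by under eq_fun do rewrite row_mxEr; exact: dg.
Qed.

Lemma partially_derivable_arg_row_mx a b c (f : 'rV[R]_(a + b) -> 'rV[R]_c) x y :
  partially_derivable f (row_mx x y) <->
  partially_derivable (fun z => f (row_mx z y)) x
  /\ partially_derivable (fun z => f (row_mx x z)) y.
Proof.
have eql h l : f (row_mx (x + h *: delta_mx 0 l) y)
    = f (row_mx x y + h *: delta_mx 0 (lshift b l)).
  by rewrite delta_mx_lshift scale_row_mx scaler0 add_row_mx addr0.
have eqr h l : f (row_mx x (y + h *: delta_mx 0 l))
    = f (row_mx x y + h *: delta_mx 0 (rshift a l)).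
  by rewrite delta_mx_rshift scale_row_mx scaler0 add_row_mx addr0.
split=> [df|[df dg] k l]; first split=> k l.
- by under eq_fun do rewrite eql; exact: df.
- by under eq_fun do rewrite eqr; exact: df.
- rewrite -(fintype.splitK l); case: (fintype.split l) => l' /=.
    by under eq_fun do rewrite -eql; exact: df.
  by under eq_fun do rewrite -eqr; exact: dg.
Qed.

Lemma C1_partially_derivable a b (f : 'rV[R]_a -> 'rV[R]_b) x :
  C1 f -> partially_derivable f x.
Proof. by move=> C1f k l; have [] := C1f k l. Qed.

End PartialJacobian.
Arguments partially_derivable_cst {R a b} c x.
Arguments C1_partially_derivable {R a b f} x _.

(** * Jacobians as linear maps acting on increments *)

Section JacobianAction.
Variable R : realType.

(** Increments are rows here, so [u *m M^T] is the action of [M] on the column [u^T]. *)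
Lemma unitmx_ker (F : fieldType) k (M : 'M[F]_k) :
  (M \in unitmx) <-> (forall u : 'rV_k, u *m M^T = 0 -> u = 0).
Proof.
rewrite -unitmx_tr; split=> [uM u uM0|inj].
  by rewrite -[u](mulmxK uM) uM0 mul0mx.
rewrite -row_free_unit -kermx_eq0; apply/eqP/row_matrixP => i.
by rewrite row0; apply: inj; rewrite -row_mul mulmx_ker row0.
Qed.

(** Separates squareness, a matter of counting equations, from injectivity, which is studied through
    kernel vectors. *)
Lemma nonsingularP r c (M : 'M[R]_(r, c)) :
  nonsingular M <-> r = c /\ (forall u : 'rV_c, u *m M^T = 0 -> u = 0).
Proof.
split=> [[e]|[e inj]].
  by case: c / e M => M; rewrite castmx_id => /unitmx_ker.
by exists e; case: c / e M inj => M inj; rewrite castmx_id; apply/unitmx_ker.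
Qed.

Lemma eq_pjac a b (f g : 'rV[R]_a -> 'rV[R]_b) x :
  f =1 g -> pjac f x = pjac g x.
Proof. by move=> /funext ->. Qed.

Lemma eq_partially_derivable a b (f g : 'rV[R]_a -> 'rV[R]_b) x :
  f =1 g -> partially_derivable f x -> partially_derivable g x.
Proof. by move=> /funext ->. Qed.

Lemma mul_tr_pjac_row_mx a b c (f : 'rV[R]_a -> 'rV[R]_b)
    (g : 'rV[R]_a -> 'rV[R]_c) (x u : 'rV[R]_a) :
  u *m (pjac (fun y => row_mx (f y) (g y)) x)^T
    = row_mx (u *m (pjac f x)^T) (u *m (pjac g x)^T).
Proof. by rewrite pjac_row_mx tr_col_mx mul_mx_row. Qed.

Lemma mul_tr_pjac_arg_row_mx a b c (f : 'rV[R]_(a + b) -> 'rV[R]_c)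
    (x : 'rV[R]_a) (y : 'rV[R]_b) (u : 'rV[R]_a) (w : 'rV[R]_b) :
  row_mx u w *m (pjac f (row_mx x y))^T
    = u *m (pjac (fun z => f (row_mx z y)) x)^T
      + w *m (pjac (fun z => f (row_mx x z)) y)^T.
Proof. by rewrite pjac_arg_row_mx tr_row_mx mul_row_col. Qed.

Lemma mul_tr_pjac_cst a b (c : 'rV[R]_b) (x u : 'rV[R]_a) :
  u *m (pjac (fun=> c) x)^T = 0.
Proof. by rewrite pjac_cst trmx0 mulmx0. Qed.

End JacobianAction.

(** * Derivatives of the device maps *)

Section DeviceJacobian.
Variables (R : realType) (nm nc nr nu : nat).
Variables (eta1 : 'rV[R]_nm -> 'rV[R]_nm -> R -> 'rV[R]_nm)
  (eta2 : 'rV[R]_nc -> R -> 'rV[R]_nc)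
  (eta3 : 'rV[R]_nr -> R -> 'rV[R]_nr)
  (eta4 : R -> 'rV[R]_nu).
Hypotheses
  (C1eta1 : C1 (fun z : 'rV[R]_(nm + nm + 1) =>
                  eta1 (lsubmx (lsubmx z)) (rsubmx (lsubmx z)) (rsubmx z 0 0)))
  (C1eta2 : C1 (fun z : 'rV[R]_(nc + 1) => eta2 (lsubmx z) (rsubmx z 0 0)))
  (C1eta3 : C1 (fun z : 'rV[R]_(nr + 1) => eta3 (lsubmx z) (rsubmx z 0 0))).
Variables (qm : 'rV[R]_nm) (qc : 'rV[R]_nc) (im : 'rV[R]_nm) (ic : 'rV[R]_nc)
  (ir : 'rV[R]_nr) (iu : 'rV[R]_nu) (t : R).
Local Notation q := (row_mx qm qc).
Local Notation i := (row_mx (row_mx im ic) (row_mx ir iu)).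

Lemma fq_row_mx (xm : 'rV[R]_nm) (xc : 'rV[R]_nc) (ym : 'rV[R]_nm)
    (yc : 'rV[R]_nc) (yr : 'rV[R]_nr) (yu : 'rV[R]_nu) :
  fq eta1 eta2 eta3 eta4 (row_mx xm xc) (row_mx (row_mx ym yc) (row_mx yr yu)) t
    = row_mx (row_mx (eta1 xm ym t) (eta2 xc t)) (row_mx (eta3 yr t) (eta4 t)).
Proof. by rewrite /fq !(row_mxKl, row_mxKr). Qed.

Lemma mul_tr_pjac_fq_q (um : 'rV[R]_nm) (uc : 'rV[R]_nc) :
  row_mx um uc *m (pjac (fun y => fq eta1 eta2 eta3 eta4 y i t) q)^T
    = row_mx (row_mx (um *m (pjac (fun y => eta1 y im t) qm)^T)
                     (uc *m (pjac (fun y => eta2 y t) qc)^T)) (row_mx 0 0).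
Proof.
rewrite mul_tr_pjac_arg_row_mx.
rewrite (eq_pjac _ (fun z => fq_row_mx z qc im ic ir iu)).
rewrite (eq_pjac _ (fun z => fq_row_mx qm z im ic ir iu)).
rewrite 6!mul_tr_pjac_row_mx 2!(mul_tr_pjac_cst (eta3 ir t)).
rewrite 2!(mul_tr_pjac_cst (eta4 t)) (mul_tr_pjac_cst (eta2 qc t)).
rewrite (mul_tr_pjac_cst (eta1 qm im t)).
by rewrite 3!add_row_mx 3!addr0 add0r.
Qed.

Lemma mul_tr_pjac_fq_i (jm : 'rV[R]_nm) (jc : 'rV[R]_nc) (jr : 'rV[R]_nr)
    (ju : 'rV[R]_nu) :
  row_mx (row_mx jm jc) (row_mx jr ju)
      *m (pjac (fun y => fq eta1 eta2 eta3 eta4 q y t) i)^T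
    = row_mx (row_mx (jm *m (pjac (fun y => eta1 qm y t) im)^T) 0)
             (row_mx (jr *m (pjac (fun y => eta3 y t) ir)^T) 0).
Proof.
rewrite !mul_tr_pjac_arg_row_mx.
rewrite (eq_pjac _ (fun z => fq_row_mx qm qc z ic ir iu)).
rewrite (eq_pjac _ (fun z => fq_row_mx qm qc im z ir iu)).
rewrite (eq_pjac _ (fun z => fq_row_mx qm qc im ic z iu)).
rewrite (eq_pjac _ (fun z => fq_row_mx qm qc im ic ir z)).
rewrite 12!mul_tr_pjac_row_mx 3!(mul_tr_pjac_cst (eta3 ir t)).
rewrite 4!(mul_tr_pjac_cst (eta4 t)) 4!(mul_tr_pjac_cst (eta2 qc t)).
rewrite 3!(mul_tr_pjac_cst (eta1 qm im t)).
by do 3![rewrite 3!add_row_mx !(addr0, add0r)].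
Qed.

Lemma partially_derivable_fq_q :
  partially_derivable (fun y => fq eta1 eta2 eta3 eta4 y i t) q.
Proof.
have d1 : partially_derivable (fun y => eta1 y im t) qm.
  (* [C1] is joint in charge, current and time. The 1 by 1 matrix [t%:M] encodes the time, and
     splitting the argument blockwise isolates the charge. *)
  have /partially_derivable_arg_row_mx[/partially_derivable_arg_row_mx[d1 _] _] :=
    C1_partially_derivable (row_mx (row_mx qm im) t%:M) C1eta1.
  apply: eq_partially_derivable d1 => y.
  by rewrite !(row_mxKl, row_mxKr) mxE mulr1n.
have d2 : partially_derivable (fun y => eta2 y t) qc.
  have /partially_derivable_arg_row_mx[d2 _] :=
    C1_partially_derivable (row_mx qc t%:M) C1eta2.
  apply: eq_partially_derivable d2 => y.
  by rewrite !(row_mxKl, row_mxKr) mxE mulr1n.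
apply/partially_derivable_arg_row_mx; split.
  apply: (eq_partially_derivable (fun z => esym (fq_row_mx z qc im ic ir iu))).
  have dmc := partially_derivable_row_mx d1 (partially_derivable_cst (eta2 qc t) _).
  exact: partially_derivable_row_mx dmc (partially_derivable_cst _ _).
apply: (eq_partially_derivable (fun z => esym (fq_row_mx qm z im ic ir iu))).
have dmc := partially_derivable_row_mx (partially_derivable_cst (eta1 qm im t) _) d2.
exact: partially_derivable_row_mx dmc (partially_derivable_cst _ _).
Qed.

Lemma partially_derivable_fq_i :
  partially_derivable (fun y => fq eta1 eta2 eta3 eta4 q y t) i.
Proof.
have d1 : partially_derivable (fun y => eta1 qm y t) im.
  have /partially_derivable_arg_row_mx[/partially_derivable_arg_row_mx[_ d1] _] :=
    C1_partially_derivable (row_mx (row_mx qm im) t%:M) C1eta1.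
  apply: eq_partially_derivable d1 => y.
  by rewrite !(row_mxKl, row_mxKr) mxE mulr1n.
have d3 : partially_derivable (fun y => eta3 y t) ir.
  have /partially_derivable_arg_row_mx[d3 _] :=
    C1_partially_derivable (row_mx ir t%:M) C1eta3.
  apply: eq_partially_derivable d3 => y.
  by rewrite !(row_mxKl, row_mxKr) mxE mulr1n.
do ![apply/partially_derivable_arg_row_mx; split].
- apply: (eq_partially_derivable (fun z => esym (fq_row_mx qm qc z ic ir iu))).
  have dmc := partially_derivable_row_mx d1 (partially_derivable_cst (eta2 qc t) _).
  exact: partially_derivable_row_mx dmc (partially_derivable_cst _ _).
- apply: (eq_partially_derivable (fun z => esym (fq_row_mx qm qc im z ir iu))).
  exact: partially_derivable_cst.
- apply: (eq_partially_derivable (fun z => esym (fq_row_mx qm qc im ic z iu))).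
  have dru := partially_derivable_row_mx d3 (partially_derivable_cst (eta4 t) _).
  exact: partially_derivable_row_mx (partially_derivable_cst _ _) dru.
- apply: (eq_partially_derivable (fun z => esym (fq_row_mx qm qc im ic ir z))).
  exact: partially_derivable_cst.
Qed.

End DeviceJacobian.

(** * Derivatives of affine maps and of six-block maps *)

Section AffineAction.
Variable R : realType.

Lemma mul_tr_pjac_lsubmx a b (x u : 'rV[R]_(a + b)) :
  u *m (pjac (fun y => lsubmx y) x)^T = lsubmx u.
Proof.
have lin (y : 'rV[R]_(a + b)) : lsubmx y = y *m lsubmx 1%:M.
  by rewrite mulmx_lsub mulmx1.
by rewrite (eq_pjac _ lin) pjac_linear trmxK -lin.
Qed.

Lemma mul_tr_pjac_cstB a b (f : 'rV[R]_a -> 'rV[R]_b) c (x u : 'rV[R]_a) :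
    partially_derivable f x ->
  u *m (pjac (fun y => c - f y) x)^T = - (u *m (pjac f x)^T).
Proof.
by move=> df; rewrite (pjac_cstD (fun y => - f y)) pjacN // linearN /= mulmxN.
Qed.

Lemma mul_tr_pjac_subcst a (c x u : 'rV[R]_a) :
  u *m (pjac (fun y => y - c) x)^T = u.
Proof. by rewrite (pjac_Dcst id) pjac_id trmx1 mulmx1. Qed.

Lemma mul_tr_pjac_mulmxD a b (M : 'M[R]_(a, b)) c (x u : 'rV[R]_a) :
  u *m (pjac (fun y => y *m M + c) x)^T = u *m M.
Proof. by rewrite (pjac_Dcst (fun y => y *m M)) pjac_linear trmxK. Qed.

Lemma mul_tr_pjac_Dmulmx a b (M : 'M[R]_(a, b)) c (x u : 'rV[R]_a) :
  u *m (pjac (fun y => c + y *m M) x)^T = u *m M.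
Proof. by rewrite (pjac_cstD (fun y => y *m M)) pjac_linear trmxK. Qed.

Lemma mul_tr_pjac_row_mx6 a b1 b2 b3 b4 b5 b6
    (f1 : 'rV[R]_a -> 'rV[R]_b1) (f2 : 'rV[R]_a -> 'rV[R]_b2)
    (f3 : 'rV[R]_a -> 'rV[R]_b3) (f4 : 'rV[R]_a -> 'rV[R]_b4)
    (f5 : 'rV[R]_a -> 'rV[R]_b5) (f6 : 'rV[R]_a -> 'rV[R]_b6) (x u : 'rV[R]_a) :
  u *m (pjac (fun y => row_mx (f1 y) (row_mx (f2 y) (row_mx (f3 y)
           (row_mx (f4 y) (row_mx (f5 y) (f6 y)))))) x)^T =
  row_mx (u *m (pjac f1 x)^T) (row_mx (u *m (pjac f2 x)^T)
    (row_mx (u *m (pjac f3 x)^T) (row_mx (u *m (pjac f4 x)^T)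
    (row_mx (u *m (pjac f5 x)^T) (u *m (pjac f6 x)^T))))).
Proof. by rewrite 5!mul_tr_pjac_row_mx. Qed.

End AffineAction.

(** * The Jacobian of the circuit equations and its kernel *)

Section CircuitJacobian.
Variables (R : realType) (nm nc nr nu nw nl ng nj p s : nat).
Variables
  (B : 'M[R]_(p, (nm + nc + (nr + nu)) + (nw + nl + (ng + nj))))
  (D : 'M[R]_(s, (nm + nc + (nr + nu)) + (nw + nl + (ng + nj))))
  (eta1 : 'rV[R]_nm -> 'rV[R]_nm -> R -> 'rV[R]_nm)
  (eta2 : 'rV[R]_nc -> R -> 'rV[R]_nc)
  (eta3 : 'rV[R]_nr -> R -> 'rV[R]_nr)
  (eta4 : R -> 'rV[R]_nu)
  (zeta1 : 'rV[R]_nw -> 'rV[R]_nw -> R -> 'rV[R]_nw)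
  (zeta2 : 'rV[R]_nl -> R -> 'rV[R]_nl)
  (zeta3 : 'rV[R]_ng -> R -> 'rV[R]_ng)
  (zeta4 : R -> 'rV[R]_nj) (t : R).
Local Notation rhs := (circuit_rhs B D eta1 eta2 eta3 eta4 zeta1 zeta2 zeta3 zeta4 t).
Local Notation F := (fun q i => fq eta1 eta2 eta3 eta4 q i t).
Local Notation Z := (fun f v => gphi zeta1 zeta2 zeta3 zeta4 f v t).

Lemma circuit_rhs_state qmc pwl vq iq vp ip :
  rhs (state_vec qmc pwl vq iq vp ip) =
  row_mx (lsubmx iq) (row_mx (lsubmx vp)
  (row_mx (vq - fq eta1 eta2 eta3 eta4 qmc iq t)
  (row_mx (ip - gphi zeta1 zeta2 zeta3 zeta4 pwl vp t)
  (row_mx (vq *m (lsubmx B)^T + vp *m (rsubmx B)^T)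
          (iq *m (lsubmx D)^T + ip *m (rsubmx D)^T))))).
Proof. by rewrite /circuit_rhs /state_vec /= !(row_mxKl, row_mxKr). Qed.

(** The vectors [a] to [f] are increments of the six state blocks. The derivative is the sum of six
    contributions, one per block with the others frozen; each equation is then constant, affine or a
    constant minus a device map. *)
Lemma mul_tr_pjac_circuit_rhs qmc pwl vq iq vp ip a b c d e f :
    partially_derivable (fun y => F y iq) qmc ->
    partially_derivable (fun y => F qmc y) iq ->
    partially_derivable (fun y => Z y vp) pwl ->
    partially_derivable (fun y => Z pwl y) vp ->
  state_vec a b c d e f *m (pjac rhs (state_vec qmc pwl vq iq vp ip))^T =
  row_mx (lsubmx d) (row_mx (lsubmx e)
  (row_mx (c - (a *m (pjac (fun y => F y iq) qmc)^T
                + d *m (pjac (fun y => F qmc y) iq)^T))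
  (row_mx (f - (b *m (pjac (fun y => Z y vp) pwl)^T
                + e *m (pjac (fun y => Z pwl y) vp)^T))
  (row_mx (row_mx c e *m B^T) (row_mx d f *m D^T))))).
Proof.
move=> dFq dFi dZp dZv.
have colq : a *m (pjac (fun y => rhs (state_vec y pwl vq iq vp ip)) qmc)^T =
    row_mx 0 (row_mx 0 (row_mx (- (a *m (pjac (fun y => F y iq) qmc)^T))
      (row_mx 0 (row_mx 0 0)))).
  rewrite (eq_pjac _ (fun y => circuit_rhs_state y pwl vq iq vp ip)).
  rewrite mul_tr_pjac_row_mx6.
  refine (f_equal2 row_mx _ (f_equal2 row_mx _ (f_equal2 row_mx _
    (f_equal2 row_mx _ (f_equal2 row_mx _ _))))).
  - exact: mul_tr_pjac_cst.
  - exact: mul_tr_pjac_cst.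
  - exact: mul_tr_pjac_cstB dFq.
  - exact: mul_tr_pjac_cst.
  - exact: mul_tr_pjac_cst.
  - exact: mul_tr_pjac_cst.
have colp : b *m (pjac (fun y => rhs (state_vec qmc y vq iq vp ip)) pwl)^T =
    row_mx 0 (row_mx 0 (row_mx 0 (row_mx
      (- (b *m (pjac (fun y => Z y vp) pwl)^T)) (row_mx 0 0)))).
  rewrite (eq_pjac _ (fun y => circuit_rhs_state qmc y vq iq vp ip)).
  rewrite mul_tr_pjac_row_mx6.
  refine (f_equal2 row_mx _ (f_equal2 row_mx _ (f_equal2 row_mx _
    (f_equal2 row_mx _ (f_equal2 row_mx _ _))))).
  - exact: mul_tr_pjac_cst.
  - exact: mul_tr_pjac_cst.
  - exact: mul_tr_pjac_cst.
  - exact: mul_tr_pjac_cstB dZp.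
  - exact: mul_tr_pjac_cst.
  - exact: mul_tr_pjac_cst.
have colvq : c *m (pjac (fun y => rhs (state_vec qmc pwl y iq vp ip)) vq)^T =
    row_mx 0 (row_mx 0 (row_mx c (row_mx 0 (row_mx (c *m (lsubmx B)^T) 0)))).
  rewrite (eq_pjac _ (fun y => circuit_rhs_state qmc pwl y iq vp ip)).
  rewrite mul_tr_pjac_row_mx6.
  refine (f_equal2 row_mx _ (f_equal2 row_mx _ (f_equal2 row_mx _
    (f_equal2 row_mx _ (f_equal2 row_mx _ _))))).
  - exact: mul_tr_pjac_cst.
  - exact: mul_tr_pjac_cst.
  - exact: mul_tr_pjac_subcst.
  - exact: mul_tr_pjac_cst.
  - exact: mul_tr_pjac_mulmxD.
  - exact: mul_tr_pjac_cst.
have coliq : d *m (pjac (fun y => rhs (state_vec qmc pwl vq y vp ip)) iq)^T =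
    row_mx (lsubmx d) (row_mx 0 (row_mx (- (d *m (pjac (fun y => F qmc y) iq)^T))
      (row_mx 0 (row_mx 0 (d *m (lsubmx D)^T))))).
  rewrite (eq_pjac _ (fun y => circuit_rhs_state qmc pwl vq y vp ip)).
  rewrite mul_tr_pjac_row_mx6.
  refine (f_equal2 row_mx _ (f_equal2 row_mx _ (f_equal2 row_mx _
    (f_equal2 row_mx _ (f_equal2 row_mx _ _))))).
  - exact: mul_tr_pjac_lsubmx.
  - exact: mul_tr_pjac_cst.
  - exact: mul_tr_pjac_cstB dFi.
  - exact: mul_tr_pjac_cst.
  - exact: mul_tr_pjac_cst.
  - exact: mul_tr_pjac_mulmxD.
have colvp : e *m (pjac (fun y => rhs (state_vec qmc pwl vq iq y ip)) vp)^T =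
    row_mx 0 (row_mx (lsubmx e) (row_mx 0
      (row_mx (- (e *m (pjac (fun y => Z pwl y) vp)^T))
        (row_mx (e *m (rsubmx B)^T) 0)))).
  rewrite (eq_pjac _ (fun y => circuit_rhs_state qmc pwl vq iq y ip)).
  rewrite mul_tr_pjac_row_mx6.
  refine (f_equal2 row_mx _ (f_equal2 row_mx _ (f_equal2 row_mx _
    (f_equal2 row_mx _ (f_equal2 row_mx _ _))))).
  - exact: mul_tr_pjac_cst.
  - exact: mul_tr_pjac_lsubmx.
  - exact: mul_tr_pjac_cst.
  - exact: mul_tr_pjac_cstB dZv.
  - exact: mul_tr_pjac_Dmulmx.
  - exact: mul_tr_pjac_cst.
have colip : f *m (pjac (fun y => rhs (state_vec qmc pwl vq iq vp y)) ip)^T =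
    row_mx 0 (row_mx 0 (row_mx 0 (row_mx f
      (row_mx 0 (f *m (rsubmx D)^T))))).
  rewrite (eq_pjac _ (fun y => circuit_rhs_state qmc pwl vq iq vp y)).
  rewrite mul_tr_pjac_row_mx6.
  refine (f_equal2 row_mx _ (f_equal2 row_mx _ (f_equal2 row_mx _
    (f_equal2 row_mx _ (f_equal2 row_mx _ _))))).
  - exact: mul_tr_pjac_cst.
  - exact: mul_tr_pjac_cst.
  - exact: mul_tr_pjac_cst.
  - exact: mul_tr_pjac_subcst.
  - exact: mul_tr_pjac_cst.
  - exact: mul_tr_pjac_Dmulmx.
rewrite /state_vec in colq colp colvq coliq colvp colip *.
rewrite 5!mul_tr_pjac_arg_row_mx colq colp colvq coliq colvp colip.
rewrite !add_row_mx !(add0r, addr0).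
(* Splitting [B] and [D] on the right matches the undivided Kirchhoff laws with the separate q and
   phi terms on the left. *)
rewrite -[in RHS](hsubmxK B) -[in RHS](hsubmxK D) !tr_row_mx !mul_row_col.
congr (row_mx _ (row_mx _ (row_mx _ (row_mx _ _)))); rewrite opprD.
  by rewrite addrCA.
by rewrite addrA addrC.
Qed.

End CircuitJacobian.

(** * The eight device classes as blocks of branch vectors *)

Section Branches.
Variables nm nc nr nu nw nl ng nj : nat.
Local Notation branch := 'I_((nm + nc + (nr + nu)) + (nw + nl + (ng + nj))).

Lemma branch_ind (P : branch -> Prop) :
    (forall i : 'I_nm, P (lshift _ (lshift _ (lshift _ i)))) ->
    (forall i : 'I_nc, P (lshift _ (lshift _ (rshift _ i)))) ->
    (forall i : 'I_nr, P (lshift _ (rshift _ (lshift _ i)))) ->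
    (forall i : 'I_nu, P (lshift _ (rshift _ (rshift _ i)))) ->
    (forall i : 'I_nw, P (rshift _ (lshift _ (lshift _ i)))) ->
    (forall i : 'I_nl, P (rshift _ (lshift _ (rshift _ i)))) ->
    (forall i : 'I_ng, P (rshift _ (rshift _ (lshift _ i)))) ->
    (forall i : 'I_nj, P (rshift _ (rshift _ (rshift _ i)))) ->
  forall b, P b.
Proof.
move=> Pm Pc Pr Pu Pw Pl Pg Pj b.
rewrite -(fintype.splitK b); case: (fintype.split b) => {}b /=;
  rewrite -(fintype.splitK b); case: (fintype.split b) => {}b /=;
  by rewrite -(fintype.splitK b); case: (fintype.split b).
Qed.

Local Notation dclass_branch := (@dclass_of nm nc nr nu nw nl ng nj).

(** Reconciles the numerical thresholds of [dclass_of] with the nested block injections. *)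
Lemma dclass_ofE :
  [/\ forall i : 'I_nm, dclass_branch (lshift _ (lshift _ (lshift _ i))) = Qmem,
      forall i : 'I_nc, dclass_branch (lshift _ (lshift _ (rshift _ i))) = Cap,
      forall i : 'I_nr, dclass_branch (lshift _ (rshift _ (lshift _ i))) = CRes
    & forall i : 'I_nu, dclass_branch (lshift _ (rshift _ (rshift _ i))) = VSrc]
  /\ [/\ forall i : 'I_nw, dclass_branch (rshift _ (lshift _ (lshift _ i))) = Pmem,
      forall i : 'I_nl, dclass_branch (rshift _ (lshift _ (rshift _ i))) = Ind,
      forall i : 'I_ng, dclass_branch (rshift _ (rshift _ (lshift _ i))) = VRes
    & forall i : 'I_nj, dclass_branch (rshift _ (rshift _ (rshift _ i))) = ISrc].
Proof.
by split; split=> i; have := ltn_ord i; rewrite /dclass_of /= => lti;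
  repeat (case: ltnP => ?; try lia).
Qed.

Variable R : realType.
Variables (xm : 'rV[R]_nm) (xc : 'rV[R]_nc) (xr : 'rV[R]_nr) (xu : 'rV[R]_nu)
  (xw : 'rV[R]_nw) (xl : 'rV[R]_nl) (xg : 'rV[R]_ng) (xj : 'rV[R]_nj).
Local Notation x := (row_mx (row_mx (row_mx xm xc) (row_mx xr xu))
                            (row_mx (row_mx xw xl) (row_mx xg xj))).

Lemma branch_entryE :
  [/\ forall i, x 0 (lshift _ (lshift _ (lshift _ i))) = xm 0 i,
      forall i, x 0 (lshift _ (lshift _ (rshift _ i))) = xc 0 i,
      forall i, x 0 (lshift _ (rshift _ (lshift _ i))) = xr 0 i
    & forall i, x 0 (lshift _ (rshift _ (rshift _ i))) = xu 0 i]
  /\ [/\ forall i, x 0 (rshift _ (lshift _ (lshift _ i))) = xw 0 i,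
      forall i, x 0 (rshift _ (lshift _ (rshift _ i))) = xl 0 i,
      forall i, x 0 (rshift _ (rshift _ (lshift _ i))) = xg 0 i
    & forall i, x 0 (rshift _ (rshift _ (rshift _ i))) = xj 0 i].
Proof. by split; split=> i; rewrite !(row_mxEl, row_mxEr). Qed.

(** Used both ways: from a given ICM-cutset to the zero blocks of its cut vector, and from the zero
    blocks of a kernel vector to the classes in its support. [VLW_support] does the same for
    currents and loops. *)
Lemma ICM_support :
  (forall b, x 0 b != 0 ->
     let c := dclass_branch b in c = ISrc \/ c = Cap \/ c = Qmem) <->
  [/\ xr = 0, xu = 0, xw = 0, xl = 0 & xg = 0].
Proof.
have [[dm dc dr du] [dw dl dg dj]] := dclass_ofE.
have [[em ec er eu] [ew el eg ej]] := branch_entryE.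
split=> [supp|[r0 u0 w0 l0 g0]].
  split; apply/rowP => i; rewrite [RHS]mxE; apply/eqP.
  - by rewrite -er; apply: contraT => /supp; rewrite dr /=; case=> // -[].
  - by rewrite -eu; apply: contraT => /supp; rewrite du /=; case=> // -[].
  - by rewrite -ew; apply: contraT => /supp; rewrite dw /=; case=> // -[].
  - by rewrite -el; apply: contraT => /supp; rewrite dl /=; case=> // -[].
  - by rewrite -eg; apply: contraT => /supp; rewrite dg /=; case=> // -[].
apply: branch_ind => i.
- by rewrite dm; right; right.
- by rewrite dc; right; left.
- by rewrite er r0 mxE eqxx.
- by rewrite eu u0 mxE eqxx.
- by rewrite ew w0 mxE eqxx.
- by rewrite el l0 mxE eqxx.
- by rewrite eg g0 mxE eqxx.
- by rewrite dj; left.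
Qed.

Lemma VLW_support :
  (forall b, x 0 b != 0 ->
     let c := dclass_branch b in c = VSrc \/ c = Ind \/ c = Pmem) <->
  [/\ xm = 0, xc = 0, xr = 0, xg = 0 & xj = 0].
Proof.
have [[dm dc dr du] [dw dl dg dj]] := dclass_ofE.
have [[em ec er eu] [ew el eg ej]] := branch_entryE.
split=> [supp|[m0 c0 r0 g0 j0]].
  split; apply/rowP => i; rewrite [RHS]mxE; apply/eqP.
  - by rewrite -em; apply: contraT => /supp; rewrite dm /=; case=> // -[].
  - by rewrite -ec; apply: contraT => /supp; rewrite dc /=; case=> // -[].
  - by rewrite -er; apply: contraT => /supp; rewrite dr /=; case=> // -[].
  - by rewrite -eg; apply: contraT => /supp; rewrite dg /=; case=> // -[].
  - by rewrite -ej; apply: contraT => /supp; rewrite dj /=; case=> // -[].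
apply: branch_ind => i.
- by rewrite em m0 mxE eqxx.
- by rewrite ec c0 mxE eqxx.
- by rewrite er r0 mxE eqxx.
- by rewrite du; left.
- by rewrite dw; right; right.
- by rewrite dl; right; left.
- by rewrite eg g0 mxE eqxx.
- by rewrite ej j0 mxE eqxx.
Qed.

End Branches.

Lemma branch_vec_split (R : realType) (nm nc nr nu nw nl ng nj : nat)
    (x : 'rV[R]_((nm + nc + (nr + nu)) + (nw + nl + (ng + nj)))) :
  exists xm xc xr xu xw xl xg xj,
    x = row_mx (row_mx (row_mx xm xc) (row_mx xr xu))
               (row_mx (row_mx xw xl) (row_mx xg xj)).
Proof.
exists (lsubmx (lsubmx (lsubmx x))), (rsubmx (lsubmx (lsubmx x))),
  (lsubmx (rsubmx (lsubmx x))), (rsubmx (rsubmx (lsubmx x))),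
  (lsubmx (lsubmx (rsubmx x))), (rsubmx (lsubmx (rsubmx x))),
  (lsubmx (rsubmx (rsubmx x))), (rsubmx (rsubmx (rsubmx x))).
by rewrite !hsubmxK.
Qed.

Lemma state_vec_eq0 (R : realType) (a b c d : nat) (q : 'rV[R]_a) (f : 'rV[R]_b)
    (vq iq : 'rV[R]_c) (vp ip : 'rV[R]_d) :
  state_vec q f vq iq vp ip = 0 ->
  [/\ q = 0, f = 0, row_mx vq vp = 0 & row_mx iq ip = 0].
Proof.
move=> /eqP; rewrite !row_mx_eq0.
case/andP=> /eqP-> /andP[/eqP-> /andP[/eqP-> /andP[/eqP-> /andP[/eqP-> /eqP->]]]].
by rewrite !row_mx0.
Qed.

Lemma state_vec_split (R : realType) (a1 a2 b1 b2 c d : nat)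
    (u : 'rV[R]_((a1 + a2) + ((b1 + b2) + (c + (c + (d + d)))))) :
  exists q1 q2 f1 f2 vq iq vp ip,
    u = state_vec (row_mx q1 q2) (row_mx f1 f2) vq iq vp ip.
Proof.
exists (lsubmx (lsubmx u)), (rsubmx (lsubmx u)), (lsubmx (lsubmx (rsubmx u))),
  (rsubmx (lsubmx (rsubmx u))), (lsubmx (rsubmx (rsubmx u))),
  (lsubmx (rsubmx (rsubmx (rsubmx u)))),
  (lsubmx (rsubmx (rsubmx (rsubmx (rsubmx u))))),
  (rsubmx (rsubmx (rsubmx (rsubmx (rsubmx u))))).
by rewrite /state_vec !hsubmxK.
Qed.

Lemma trmx_1x1 (T : Type) (M : 'M[T]_1) : M^T = M.
Proof. by apply/matrixP => i j; rewrite mxE !ord1. Qed.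

(** A 1 by 1 matrix equals its transpose, so [P] and [P^T] have the same quadratic form even when
    [P] is not symmetric. *)
Lemma posdef_dot (R : realType) k (P : 'M[R]_k) (u : 'rV_k) :
    posdef P ->
  0 <= (u *m P^T *m u^T) 0 0 /\ ((u *m P^T *m u^T) 0 0 = 0 -> u = 0).
Proof.
move=> pP; have -> : (u *m P^T *m u^T) 0 0 = (u *m P *m u^T) 0 0.
  by rewrite -(trmx_1x1 (u *m P^T *m _)) !trmx_mul !trmxK mulmxA.
have [->|/pP u_gt0] := eqVneq u 0; first by rewrite !mul0mx mxE lexx.
by split=> [|u0]; [exact: ltW|move: u_gt0; rewrite u0 ltxx].
Qed.

(** * The linearized circuit equations and the triviality of their kernel *)

Section Kernel.
Variables (R : realType) (nm nc nr nu nw nl ng nj p s : nat).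
Variables
  (B : 'M[R]_(p, (nm + nc + (nr + nu)) + (nw + nl + (ng + nj))))
  (D : 'M[R]_(s, (nm + nc + (nr + nu)) + (nw + nl + (ng + nj))))
  (eta1 : 'rV[R]_nm -> 'rV[R]_nm -> R -> 'rV[R]_nm)
  (eta2 : 'rV[R]_nc -> R -> 'rV[R]_nc)
  (eta3 : 'rV[R]_nr -> R -> 'rV[R]_nr)
  (eta4 : R -> 'rV[R]_nu)
  (zeta1 : 'rV[R]_nw -> 'rV[R]_nw -> R -> 'rV[R]_nw)
  (zeta2 : 'rV[R]_nl -> R -> 'rV[R]_nl)
  (zeta3 : 'rV[R]_ng -> R -> 'rV[R]_ng)
  (zeta4 : R -> 'rV[R]_nj).
Hypotheses
  (C1eta1 : C1 (fun z : 'rV[R]_(nm + nm + 1) =>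
                  eta1 (lsubmx (lsubmx z)) (rsubmx (lsubmx z)) (rsubmx z 0 0)))
  (C1eta2 : C1 (fun z : 'rV[R]_(nc + 1) => eta2 (lsubmx z) (rsubmx z 0 0)))
  (C1eta3 : C1 (fun z : 'rV[R]_(nr + 1) => eta3 (lsubmx z) (rsubmx z 0 0)))
  (C1zeta1 : C1 (fun z : 'rV[R]_(nw + nw + 1) =>
                  zeta1 (lsubmx (lsubmx z)) (rsubmx (lsubmx z)) (rsubmx z 0 0)))
  (C1zeta2 : C1 (fun z : 'rV[R]_(nl + 1) => zeta2 (lsubmx z) (rsubmx z 0 0)))
  (C1zeta3 : C1 (fun z : 'rV[R]_(ng + 1) => zeta3 (lsubmx z) (rsubmx z 0 0))).
Variables (t : R) (qmc : 'rV[R]_(nm + nc)) (pwl : 'rV[R]_(nw + nl))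
  (vq iq : 'rV[R]_(nm + nc + (nr + nu)))
  (vp ip : 'rV[R]_(nw + nl + (ng + nj))).

Local Notation rhs := (circuit_rhs B D eta1 eta2 eta3 eta4 zeta1 zeta2 zeta3 zeta4 t).
Local Notation Em := (pjac (fun q => eta1 q (lsubmx (lsubmx iq)) t) (lsubmx qmc)).
Local Notation Ec := (pjac (fun q => eta2 q t) (rsubmx qmc)).
Local Notation Rr := (pjac (fun i => eta3 i t) (lsubmx (rsubmx iq))).
Local Notation Rw := (pjac (fun f => zeta1 f (lsubmx (lsubmx vp)) t) (lsubmx pwl)).
Local Notation Rl := (pjac (fun f => zeta2 f t) (rsubmx pwl)).
Local Notation Gg := (pjac (fun v => zeta3 v t) (lsubmx (rsubmx vp))).

(** The rows of [q' = i] and [phi' = v] kill the q-memristor currents and the phi-memristor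
    voltages. Only the elastance and reluctance terms of memristors survive, so they act like
    capacitors and inductors. *)
Lemma pjac_circuit_kernel
    (am : 'rV[R]_nm) (ac : 'rV[R]_nc) (bw : 'rV[R]_nw) (bl : 'rV[R]_nl)
    (vm im : 'rV[R]_nm) (vc ic : 'rV[R]_nc) (vr ir : 'rV[R]_nr) (vu iu : 'rV[R]_nu)
    (vw iw : 'rV[R]_nw) (vl il : 'rV[R]_nl) (vg ig : 'rV[R]_ng) (vj ij : 'rV[R]_nj) :
  let dvq := row_mx (row_mx vm vc) (row_mx vr vu) in
  let diq := row_mx (row_mx im ic) (row_mx ir iu) in
  let dvp := row_mx (row_mx vw vl) (row_mx vg vj) in
  let dip := row_mx (row_mx iw il) (row_mx ig ij) in
  state_vec (row_mx am ac) (row_mx bw bl) dvq diq dvp dip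
      *m (pjac rhs (state_vec qmc pwl vq iq vp ip))^T = 0 <->
  [/\ [/\ im = 0, ic = 0, vw = 0 & vl = 0],
      [/\ vm = am *m Em^T, vc = ac *m Ec^T, vr = ir *m Rr^T & vu = 0],
      [/\ iw = bw *m Rw^T, il = bl *m Rl^T, ig = vg *m Gg^T & ij = 0],
      row_mx dvq dvp *m B^T = 0 & row_mx diq dip *m D^T = 0].
Proof.
move=> dvq diq dvp dip.
have iqE : iq = row_mx (row_mx (lsubmx (lsubmx iq)) (rsubmx (lsubmx iq)))
    (row_mx (lsubmx (rsubmx iq)) (rsubmx (rsubmx iq))) by rewrite !hsubmxK.
have vpE : vp = row_mx (row_mx (lsubmx (lsubmx vp)) (rsubmx (lsubmx vp)))
    (row_mx (lsubmx (rsubmx vp)) (rsubmx (rsubmx vp))) by rewrite !hsubmxK.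
have qE : qmc = row_mx (lsubmx qmc) (rsubmx qmc) by rewrite hsubmxK.
have pE : pwl = row_mx (lsubmx pwl) (rsubmx pwl) by rewrite hsubmxK.
(* Naming the blocks of the base point brings it to the concatenated form in which the device
   derivatives are stated. *)
move: (lsubmx (lsubmx iq)) (rsubmx (lsubmx iq)) (lsubmx (rsubmx iq))
  (rsubmx (rsubmx iq)) (lsubmx qmc) (rsubmx qmc) iqE qE.
move=> im0 ic0 ir0 iu0 qm0 qc0 -> ->.
move: (lsubmx (lsubmx vp)) (rsubmx (lsubmx vp)) (lsubmx (rsubmx vp))
  (rsubmx (rsubmx vp)) (lsubmx pwl) (rsubmx pwl) vpE pE.
move=> vw0 vl0 vg0 vj0 pw0 pl0 -> ->.
have Fq := mul_tr_pjac_fq_q eta1 eta2 eta3 eta4 qm0 qc0 im0 ic0 ir0 iu0 t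
  am ac.
have Fi := mul_tr_pjac_fq_i eta1 eta2 eta3 eta4 qm0 qc0 im0 ic0 ir0 iu0 t
  im ic ir iu.
have Zp : row_mx bw bl *m _ = _ :=
  mul_tr_pjac_fq_q zeta1 zeta2 zeta3 zeta4 pw0 pl0 vw0 vl0 vg0 vj0 t bw bl.
have Zv : row_mx (row_mx vw vl) (row_mx vg vj) *m _ = _ :=
  mul_tr_pjac_fq_i zeta1 zeta2 zeta3 zeta4 pw0 pl0 vw0 vl0 vg0 vj0 t
    vw vl vg vj.
(* [gphi] and [fq] have the same body, so the lemmas on [fq] cover both. *)
rewrite -[@fq R nw nl ng nj]/(@gphi R nw nl ng nj) in Zp Zv.
rewrite mul_tr_pjac_circuit_rhs; first last.
- exact: (@partially_derivable_fq_i _ nw nl ng nj zeta1 zeta2 zeta3 zeta4).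
- exact: (@partially_derivable_fq_q _ nw nl ng nj zeta1 zeta2 zeta3 zeta4).
- exact: partially_derivable_fq_i.
- exact: partially_derivable_fq_q.
rewrite Fq Fi Zp Zv !row_mxKl !add_row_mx !opp_row_mx !add_row_mx.
rewrite !(addr0, add0r, subr0).
split=> [/eqP|[[-> -> -> ->] [-> -> -> ->] [-> -> -> ->] -> ->]]; last first.
  by rewrite !mul0mx !addr0 !subrr !row_mx0.
rewrite !row_mx_eq0 !subr_eq0.
case/andP=> /andP[/eqP im_0 /eqP ic_0] /andP[/andP[/eqP vw_0 /eqP vl_0]].
case/andP=> /andP[/andP[/eqP vmE /eqP vcE] /andP[/eqP vrE /eqP vuE]].
case/andP=> /andP[/andP[/eqP iwE /eqP ilE] /andP[/eqP igE /eqP ijE]].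
case/andP=> /eqP HB /eqP HD.
rewrite im_0 mul0mx addr0 in vmE; rewrite vw_0 mul0mx addr0 in iwE.
by [].
Qed.

(* Tellegen: the branch voltages and currents of a kernel vector are orthogonal,
   and only resistors contribute to their product. *)
Lemma pjac_circuit_inj (n : nat)
    (src tgt : 'I_((nm + nc + (nr + nu)) + (nw + nl + (ng + nj))) -> 'I_n) :
    reduced_loop_matrix src tgt B -> reduced_cutset_matrix src tgt D ->
    posdef Rr -> posdef Gg ->
    Em \in unitmx -> Ec \in unitmx -> Rw \in unitmx -> Rl \in unitmx ->
    ~ has_VLW_loop src tgt -> ~ has_ICM_cutset src tgt ->
  forall u : 'rV[R]_((nm + nc) + ((nw + nl) + ((nm + nc + (nr + nu))
          + ((nm + nc + (nr + nu)) + ((nw + nl + (ng + nj))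
          + (nw + nl + (ng + nj))))))),
    u *m (pjac rhs (state_vec qmc pwl vq iq vp ip))^T = 0 -> u = 0.
Proof.
move=> HB HD HR HG HEm HEc HRw HRl noVLW noICM u.
have [am [ac [bw [bl [dvq [diq [dvp [dip ->]]]]]]]] := state_vec_split u.
have [vm [vc [vr [vu [vw [vl [vg [vj]]]]]]]] := branch_vec_split (row_mx dvq dvp).
have [im [ic [ir [iu [iw [il [ig [ij]]]]]]]] := branch_vec_split (row_mx diq dip).
move=> /eq_row_mx[-> ->] /eq_row_mx[-> ->].
move=> /pjac_circuit_kernel[[im0 ic0 vw0 vl0] [vmE vcE vrE vu0] [iwE ilE igE ij0]].
move=> /(loop_matrix_kernel _ HB) vA.
move=> /(cutset_matrix_kernel _ HD) iA.
(* With [v = pot *m A], the product of voltages and currents vanishes by the current law. Outside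
   the resistors each term has a zero factor: the current for q-memristors, capacitors and current
   sources, the voltage for voltage sources, phi-memristors and inductors. *)
have tellegen : (vr *m ir^T) 0 0 + (vg *m ig^T) 0 0 = 0.
  have /submxP[pot vE] := vA.
  have : (row_mx (row_mx (row_mx vm vc) (row_mx vr vu))
            (row_mx (row_mx vw vl) (row_mx vg vj)) *m
          (row_mx (row_mx (row_mx im ic) (row_mx ir iu))
            (row_mx (row_mx iw il) (row_mx ig ij)))^T) = 0.
    by rewrite vE -mulmxA -[incidence _ _ _]trmxK -trmx_mul iA trmx0 mulmx0.
  rewrite !tr_row_mx !mul_row_col im0 ic0 vu0 vw0 vl0 ij0 !trmx0.
  rewrite !(mulmx0, mul0mx, addr0, add0r) => /matrixP/(_ 0 0).
  by rewrite !mxE.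
have [r_ge0 r_eq0] := posdef_dot ir HR.
have [g_ge0 g_eq0] := posdef_dot vg HG.
have igE' : (vg *m ig^T) 0 0 = (vg *m Gg^T *m vg^T) 0 0.
  rewrite igE trmx_mul mulmxA trmxK.
  by rewrite -(trmx_1x1 (vg *m _ *m _)) !trmx_mul trmxK mulmxA.
move/eqP: tellegen; rewrite igE' vrE paddr_eq0 // => /andP[/eqP/r_eq0 ir0 /eqP/g_eq0 vg0].
have {}vr0 : vr = 0 by rewrite vrE ir0 mul0mx.
have {}ig0 : ig = 0 by rewrite igE vg0 mul0mx.
have [v0|vn0] := eqVneq (row_mx (row_mx (row_mx vm vc) (row_mx vr vu))
    (row_mx (row_mx vw vl) (row_mx vg vj))) 0; last first.
  have [S cS Sv] := tension_support_cutset vA vn0.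
  case: noICM; exists S; split=> // k /Sv; move: k.
  by apply/ICM_support; rewrite vr0 vu0 vw0 vl0 vg0.
have [i0|in0] := eqVneq (row_mx (row_mx (row_mx im ic) (row_mx ir iu))
    (row_mx (row_mx iw il) (row_mx ig ij))) 0; last first.
  have [k [xs [bs [cyc ibs]]]] := circulation_support_cycle iA in0.
  case: noVLW; exists k, xs, bs; split=> // j; move: (ibs j); move: (bs j).
  by apply/VLW_support; rewrite im0 ic0 ir0 ig0 ij0.
have := v0; move/eqP; rewrite !row_mx_eq0.
case/andP=> /andP[/andP[/eqP vm0 /eqP vc0] _] _.
have := i0; move/eqP; rewrite !row_mx_eq0.
case/andP=> _ /andP[/andP[/eqP iw0 /eqP il0] _].
move/unitmx_ker: HEm => /(_ am) ->; last by rewrite -vmE.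
move/unitmx_ker: HEc => /(_ ac) ->; last by rewrite -vcE.
move/unitmx_ker: HRw => /(_ bw) ->; last by rewrite -iwE.
move/unitmx_ker: HRl => /(_ bl) ->; last by rewrite -ilE.
move/eqP: v0; rewrite -vrE row_mx_eq0 => /andP[/eqP -> /eqP ->].
move/eqP: i0; rewrite row_mx_eq0 => /andP[/eqP -> /eqP ->].
by rewrite /state_vec !row_mx0.
Qed.

End Kernel.

Unset Implicit Arguments.
Set Strict Implicit.

Theorem theorem2 (R : realType) (n nm nc nr nu nw nl ng nj p s : nat)
  (src tgt : 'I_((nm + nc + (nr + nu)) + (nw + nl + (ng + nj))) -> 'I_n)
  (B : 'M[R]_(p, (nm + nc + (nr + nu)) + (nw + nl + (ng + nj))))
  (D : 'M[R]_(s, (nm + nc + (nr + nu)) + (nw + nl + (ng + nj))))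
  (eta1 : 'rV[R]_nm -> 'rV[R]_nm -> R -> 'rV[R]_nm)
  (eta2 : 'rV[R]_nc -> R -> 'rV[R]_nc)
  (eta3 : 'rV[R]_nr -> R -> 'rV[R]_nr)
  (eta4 : R -> 'rV[R]_nu)
  (zeta1 : 'rV[R]_nw -> 'rV[R]_nw -> R -> 'rV[R]_nw)
  (zeta2 : 'rV[R]_nl -> R -> 'rV[R]_nl)
  (zeta3 : 'rV[R]_ng -> R -> 'rV[R]_ng)
  (zeta4 : R -> 'rV[R]_nj)
  (* reduced loop and cutset matrices of the circuit digraph *)
  (HB : reduced_loop_matrix src tgt B)
  (HD : reduced_cutset_matrix src tgt D)
  (* the device maps are C^1 (time is the last argument) *)
  (C1eta1 : C1 (fun z : 'rV[R]_(nm + nm + 1) =>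
                  eta1 (lsubmx (lsubmx z)) (rsubmx (lsubmx z)) (rsubmx z 0 0)))
  (C1eta2 : C1 (fun z : 'rV[R]_(nc + 1) => eta2 (lsubmx z) (rsubmx z 0 0)))
  (C1eta3 : C1 (fun z : 'rV[R]_(nr + 1) => eta3 (lsubmx z) (rsubmx z 0 0)))
  (C1eta4 : C1 (fun z : 'rV[R]_1 => eta4 (z 0 0)))
  (C1zeta1 : C1 (fun z : 'rV[R]_(nw + nw + 1) =>
                  zeta1 (lsubmx (lsubmx z)) (rsubmx (lsubmx z)) (rsubmx z 0 0)))
  (C1zeta2 : C1 (fun z : 'rV[R]_(nl + 1) => zeta2 (lsubmx z) (rsubmx z 0 0)))
  (C1zeta3 : C1 (fun z : 'rV[R]_(ng + 1) => zeta3 (lsubmx z) (rsubmx z 0 0)))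
  (C1zeta4 : C1 (fun z : 'rV[R]_1 => zeta4 (z 0 0)))
  (* memristors: the partial derivatives of eta1, zeta1 are not identically 0 *)
  (Hm1 : (0 < nm)%N -> exists q i t, pjac (fun q' => eta1 q' i t) q != 0)
  (Hm2 : (0 < nm)%N -> exists q i t, pjac (fun i' => eta1 q i' t) i != 0)
  (Hw1 : (0 < nw)%N -> exists f v t, pjac (fun f' => zeta1 f' v t) f != 0)
  (Hw2 : (0 < nw)%N -> exists f v t, pjac (fun v' => zeta1 f v' t) v != 0)
  (* positive definite incremental resistance and conductance matrices *)
  (HR : forall (ir : 'rV[R]_nr) (t : R), posdef (pjac (fun i => eta3 i t) ir))
  (HG : forall (vg : 'rV[R]_ng) (t : R), posdef (pjac (fun v => zeta3 v t) vg))
  (* an equilibrium point (q_mc, phi_wl, v_q, i_q, v_phi, i_phi) at time t0 *)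
  (t0 : R) (qmc : 'rV[R]_(nm + nc)) (pwl : 'rV[R]_(nw + nl))
  (vq iq : 'rV[R]_(nm + nc + (nr + nu)))
  (vp ip : 'rV[R]_(nw + nl + (ng + nj)))
  (Heq : circuit_rhs B D eta1 eta2 eta3 eta4 zeta1 zeta2 zeta3 zeta4 t0
           (state_vec qmc pwl vq iq vp ip) = 0) :
  (* regular: the Jacobian K of the right-hand sides is non-singular *)
  nonsingular (pjac (circuit_rhs B D eta1 eta2 eta3 eta4
                                 zeta1 zeta2 zeta3 zeta4 t0)
                    (state_vec qmc pwl vq iq vp ip))
  <->
  (* (i) E_m, E_c, Rel_w, Rel_l non-singular at the equilibrium *)
  ((pjac (fun q => eta1 q (lsubmx (lsubmx iq)) t0) (lsubmx qmc) \in unitmx)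
   /\ (pjac (fun q => eta2 q t0) (rsubmx qmc) \in unitmx)
   /\ (pjac (fun f => zeta1 f (lsubmx (lsubmx vp)) t0) (lsubmx pwl) \in unitmx)
   /\ (pjac (fun f => zeta2 f t0) (rsubmx pwl) \in unitmx))
  (* (ii) neither VLW-loops nor ICM-cutsets *)
  /\ ~ has_VLW_loop src tgt /\ ~ has_ICM_cutset src tgt.
Proof.
have dim := reduced_matrices_dim HB HD.
have ker := pjac_circuit_kernel B D eta4 zeta4 C1eta1 C1eta2 C1eta3 C1zeta1 C1zeta2 C1zeta3 t0 qmc pwl vq iq vp ip.
split=> [/nonsingularP[_ inj]|[[HEm [HEc [HRw HRl]]] [noVLW noICM]]]; last first.
  (* The unknowns contain the q- and phi-branches twice, the equations once plus [p + s] Kirchhoff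
     laws; [dim] says that the latter number equals that of all branches. *)
  apply/nonsingularP; split; first by rewrite dim; lia.
  exact: (pjac_circuit_inj C1eta1 C1eta2 C1eta3 C1zeta1 C1zeta2 C1zeta3 HB HD
    (HR _ _) (HG _ _) HEm HEc HRw HRl noVLW noICM).
pose zq : 'rV[R]_(nm + nc + (nr + nu)) := row_mx (row_mx 0 0) (row_mx 0 0).
pose zp : 'rV[R]_(nw + nl + (ng + nj)) := row_mx (row_mx 0 0) (row_mx 0 0).
(* Test vectors with zero voltages and currents: on them the kernel equations reduce to those of the
   four characteristic matrices. *)
have charge_flux0 (am : 'rV_nm) (ac : 'rV_nc) (bw : 'rV_nw) (bl : 'rV_nl) :
    am *m (pjac (fun q => eta1 q (lsubmx (lsubmx iq)) t0) (lsubmx qmc))^T = 0 ->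
    ac *m (pjac (fun q => eta2 q t0) (rsubmx qmc))^T = 0 ->
    bw *m (pjac (fun f => zeta1 f (lsubmx (lsubmx vp)) t0) (lsubmx pwl))^T = 0 ->
    bl *m (pjac (fun f => zeta2 f t0) (rsubmx pwl))^T = 0 ->
  [/\ am = 0, ac = 0, bw = 0 & bl = 0].
  move=> am0 ac0 bw0 bl0.
  have /state_vec_eq0[] : state_vec (row_mx am ac) (row_mx bw bl)
      zq zq zp zp = 0.
    by apply: inj; apply/ker; rewrite am0 ac0 bw0 bl0 !row_mx0 !mul0mx.
  move=> /eqP + /eqP; rewrite !row_mx_eq0.
  by move=> /andP[/eqP-> /eqP->] /andP[/eqP-> /eqP->].
have units : [/\ pjac (fun q => eta1 q (lsubmx (lsubmx iq)) t0) (lsubmx qmc) \in unitmx,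
    pjac (fun q => eta2 q t0) (rsubmx qmc) \in unitmx,
    pjac (fun f => zeta1 f (lsubmx (lsubmx vp)) t0) (lsubmx pwl) \in unitmx
  & pjac (fun f => zeta2 f t0) (rsubmx pwl) \in unitmx].
  split; apply/unitmx_ker => u u0.
  - by have [] := charge_flux0 u 0 0 0 u0 (mul0mx _ _) (mul0mx _ _) (mul0mx _ _).
  - by have [] := charge_flux0 0 u 0 0 (mul0mx _ _) u0 (mul0mx _ _) (mul0mx _ _).
  - by have [] := charge_flux0 0 0 u 0 (mul0mx _ _) (mul0mx _ _) u0 (mul0mx _ _).
  - by have [] := charge_flux0 0 0 0 u (mul0mx _ _) (mul0mx _ _) (mul0mx _ _) u0.
have [HEm HEc HRw HRl] := units; do ![split=> //].
- move=> [k [xs [bs [cyc classes]]]].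
  have [i [_ iA i_neq0 i_bs]] := cycle_row R cyc.
  have [im [ic [ir [iu [iw [il [ig [ij iE]]]]]]]] := branch_vec_split i.
  have supp b : i 0 b != 0 ->
      let c := dclass_of b in c = VSrc \/ c = Ind \/ c = Pmem.
    by move=> /i_bs[j <-]; exact: classes.
  rewrite iE in iA i_neq0 supp.
  have [im0 ic0 ir0 ig0 ij0] := iffLR (VLW_support _ _ _ _ _ _ _ _) supp.
  (* Kernel vector of a VLW-loop: the loop vector as currents, zero voltages and charges, and the
     fluxes that produce these currents through the inverted reluctances. *)
  have /state_vec_eq0[_ _ _ i0] : state_vec (row_mx (0 : 'rV_nm) (0 : 'rV_nc)) (row_mx
      (iw *m invmx (pjac (fun f => zeta1 f (lsubmx (lsubmx vp)) t0) (lsubmx pwl))^T)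
      (il *m invmx (pjac (fun f => zeta2 f t0) (rsubmx pwl))^T))
      zq (row_mx (row_mx im ic) (row_mx ir iu))
      zp (row_mx (row_mx iw il) (row_mx ig ij)) = 0.
    apply: inj; apply/ker; split; first by [].
    - by rewrite ir0 !mul0mx.
    - by rewrite !mulmxKV ?unitmx_tr // mul0mx.
    - by rewrite !row_mx0 mul0mx.
    - exact/(cutset_matrix_kernel _ HD).
  by rewrite i0 eqxx in i_neq0.
- move=> [S [cS classes]].
  have [v [_ vA v_neq0 vS]] := cutset_row R cS.
  have [vm [vc [vr [vu [vw [vl [vg [vj vE]]]]]]]] := branch_vec_split v.
  have supp b : v 0 b != 0 ->
      let c := dclass_of b in c = ISrc \/ c = Cap \/ c = Qmem.
    by move=> /vS; exact: classes.
  rewrite vE in vA v_neq0 supp.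
  have [vr0 vu0 vw0 vl0 vg0] := iffLR (ICM_support _ _ _ _ _ _ _ _) supp.
  (* Dually for an ICM-cutset: the cut vector as voltages, zero currents and fluxes, and the charges
     given by the inverted elastances. *)
  have /state_vec_eq0[_ _ v0 _] : state_vec (row_mx
      (vm *m invmx (pjac (fun q => eta1 q (lsubmx (lsubmx iq)) t0) (lsubmx qmc))^T)
      (vc *m invmx (pjac (fun q => eta2 q t0) (rsubmx qmc))^T)) (row_mx (0 : 'rV_nw) (0 : 'rV_nl))
      (row_mx (row_mx vm vc) (row_mx vr vu)) zq
      (row_mx (row_mx vw vl) (row_mx vg vj)) zp = 0.
    apply: inj; apply/ker; split; first by [].
    - by rewrite !mulmxKV ?unitmx_tr // mul0mx.
    - by rewrite vg0 !mul0mx.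
    - exact/(loop_matrix_kernel _ HB).
    - by rewrite !row_mx0 mul0mx.
  by rewrite v0 eqxx in v_neq0.
Qed.
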